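(* Let $p\ge1$, $T>0$, $\omega>\Lambda>0$, $z\in(0,1)$ and let $n$ be a positive integer with $n\ge\frac{\omega T}{\pi\sqrt z}$. Let $\varphi$ be an Orlicz N-function satisfying Condition Q, with density $f$ and Young-Fenchel transform $\varphi^*$. Let $\mathbf X(t)$, $t\in\mathbb R$, be a stationary $SSub_\varphi(\Omega)$ process with determinative constant $C_{\mathbf X}$, whose spectrum is bandlimited to $[-\Lambda,\Lambda)$, let $\mathbf X_n(t)$ be its truncated sampling sum with parameter $\omega$, and let $$S_{n,p}:=\left(\frac{C_{\mathbf X}}{n}\right)^p\int_0^T C_n^{p/2}(t)\,dt,\qquad C_n(t):=\mathbf B(0)\cdot\left(\frac{4\omega t}{\pi^2(1-z)}+\frac{4\left(z+1+\frac1n\right)}{\pi(1-z)^2\left(1-\frac{\Lambda}{\omega}\right)}\right)^2 .$$ Then $\int_0^T|\mathbf X(t)-\mathbf X_n(t)|^p\,dt$ exists with probability $1$, and for every $\varepsilon>S_{n,p}\cdot\left(f\left(p\,(S_{n,p}/\varepsilon)^{1/p}\right)\right)^p$, $$\mathbf P\left\{\int_0^T\left|\mathbf X(t)-\mathbf X_n(t)\right|^p\,dt>\varepsilon\right\}\le2\exp\left\{-\varphi^*\left(\left(\varepsilon/S_{n,p}\right)^{1/p}\right)\right\}.$$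
   Context: Orlicz N-function: a continuous even convex function $\varphi:\mathbb R\to\mathbb R$, monotonically increasing for $x>0$, with $\varphi(0)=0$, $\varphi(x)/x\to0$ as $x\to0$ and $\varphi(x)/x\to\infty$ as $x\to\infty$. Condition Q: $\lim_{x\to0}\varphi(x)/x^2=C>0$, where $C=+\infty$ is allowed. Young-Fenchel transform: $\varphi^*(x):=\sup_{y\in\mathbb R}(xy-\varphi(y))$. Density: $\varphi$ can be written as $\varphi(u)=\int_0^{|u|}f(v)\,dv$ with $f$ monotonically non-decreasing, right-continuous, $f(0)=0$ and $f(x)\to+\infty$ as $x\to+\infty$; this $f$ is the density of $\varphi$. A zero-mean random variable $\xi$ on a standard probability space belongs to $Sub_\varphi(\Omega)$ if there is a constant $a_\xi\ge0$ with $\mathbf E\exp(\lambda\xi)\le\exp(\varphi(a_\xi\lambda))$ for all $\lambda\in\mathbb R$. Its norm is $\tau_\varphi(\xi):=\sup_{\lambda\ne0}\varphi^{(-1)}(\ln\mathbf E\exp\{\lambda\xi\})/|\lambda|$, where $\varphi^{(-1)}$ is the inverse function of $\varphi$ (restricted to $[0,\infty)$). A process $\mathbf X(t)$ is an $SSub_\varphi(\Omega)$ (strictly $Sub_\varphi(\Omega)$) process with determinative constant $C_{\mathbf X}>0$ if every $\mathbf X(t)\in Sub_\varphi(\Omega)$ and, for all finite collections of time points $t_i$ and reals $\lambda_i$, $i\in I$, $\tau_\varphi\left(\sum_{i\in I}\lambda_i\mathbf X(t_i)\right)\le C_{\mathbf X}\left(\mathbf E\left(\sum_{i\in I}\lambda_i\mathbf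 X(t_i)\right)^2\right)^{1/2}$. A zero-mean stationary process has spectrum bandlimited to $[-\Lambda,\Lambda)$ if $\mathbf B(\tau):=\mathbf E\,\mathbf X(t+\tau)\mathbf X(t)=\int_{-\Lambda}^{\Lambda}e^{i\tau\lambda}\,dF(\lambda)$ with $F$ its spectral function. The truncated sampling sum is $$\mathbf X_n(t):=\sum_{k=-n}^n\frac{\sin\left(\omega\left(t-\frac{k\pi}{\omega}\right)\right)}{\omega\left(t-\frac{k\pi}{\omega}\right)}\,\mathbf X\left(\frac{k\pi}{\omega}\right),$$ where $\sin(x)/x$ is understood as $1$ at $x=0$.
   Formalization: The process X is additionally assumed jointly measurable in time and chance; without this a modification of X with non-measurable paths satisfies every hypothesis while the path integral fails to exist. *)

(* Defs.v *)
From HB Require Import structures.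
From mathcomp Require Import all_boot all_order all_algebra.
From mathcomp Require Import complex.
From mathcomp Require Import all_classical all_reals all_analysis.

Set Implicit Arguments.
Unset Strict Implicit.
Unset Printing Implicit Defensive.

Import Order.TTheory GRing.Theory Num.Theory.
Import numFieldNormedType.Exports.

Local Open Scope classical_set_scope.
Local Open Scope ring_scope.

Section orlicz.
Context {R : realType}.
Implicit Types phi f : R -> R.

Definition orlicz_N_function phi : Prop :=
  [/\ continuous phi,
      forall x, phi (- x) = phi x,
      convex_function [set: R^o] phi,
      forall x y, 0 < x -> x < y -> phi x < phi y &
      [/\ phi 0 = 0,
          phi x / x @[x --> 0^'] --> 0 &
          phi x / x @[x --> +oo] --> +oo]].

Definition condition_Q phi : Prop :=
  exists2 C : \bar R, (0 < C)%E &
    (phi x / x ^+ 2)%:E @[x --> 0^'] --> C.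

(* A density lives on [0, +oo[: its values at negative arguments are
   unconstrained. *)
Definition is_density phi f : Prop :=
  [/\ {in `[0, +oo[ &, {homo f : x y / x <= y}},
      forall x, 0 <= x -> f v @[v --> x^'+] --> f x,
      f 0 = 0,
      f x @[x --> +oo] --> +oo &
      forall u, (phi u)%:E =
        (\int[lebesgue_measure]_(v in `[0%R, `|u|%R]) (f v)%:E)%E].

(* For an N-function the set below is nonempty and bounded above, so that this
   real-valued supremum is the true one. *)
Definition young_fenchel phi (x : R) : R :=
  sup [set x * y - phi y | y in [set: R]].

(* The inverse of the restriction of phi to [0, +oo[, extended so that the
   inverse of +oo is +oo. *)
Definition orlicz_inv phi (y : \bar R) : \bar R :=
  if y is r%:E then (pinv ([set` `[0, +oo[] : set R) phi r)%:E else y.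

End orlicz.

Section subphi.
Context {d : measure_display} {Omega : measurableType d} {R : realType}.
Variable P : probability Omega R.
Implicit Types (phi : R -> R) (xi : Omega -> R) (X : R -> Omega -> R).

Definition Sub phi xi : Prop :=
  [/\ measurable_fun [set: Omega] xi,
      'E_P[xi]%E = 0%E &
      exists2 a : R, 0 <= a &
        forall l : R, ('M_P xi l <= (expR (phi (a * l)))%:E)%E].

Definition tau phi xi : \bar R :=
  ereal_sup [set (orlicz_inv phi (lne ('M_P xi l)) * (`|l|^-1)%:E)%E
            | l in [set l : R | l != 0]].

Definition SSub phi X (C : R) : Prop :=
  [/\ 0 < C,
      forall t, Sub phi (X t) &
      forall (m : nat) (t l : 'I_m -> R),
        let Y := fun w => \sum_(i < m) l i * X (t i) w in
        (tau phi Y <= C%:E * 'E_P[(fun w => Y w ^+ 2)%R] `^ (2^-1)%R)%E].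

(* Joint measurability in time and chance, without which the paths of X need
   not be measurable functions of time. *)
Definition measurable_process X : Prop :=
  measurable_fun [set: R * Omega] (fun x => X x.1 x.2).

(* Zero-mean stationarity in the wide sense, with covariance function B. *)
Definition stationary X (B : R -> R) : Prop :=
  (forall t, 'E_P[X t]%E = 0%E) /\
  (forall t s, 'E_P[(fun w => X (t + s) w * X t w)%R]%E = (B s)%:E).

End subphi.

Section bandlimited.
Context {R : realType}.

Definition expi (x : R) : R[i] := (cos x +i* sin x)%C.

Definition complex_integral d (T : measurableType d)
    (mu : {measure set T -> \bar R}) (D : set T) (g : T -> R[i]) : R[i] :=
  (Rintegral mu D (fun x => complex.Re (g x)) +i*
   Rintegral mu D (fun x => complex.Im (g x)))%C.

(* [F] is the spectral function; only its Stieltjes measure on the half-open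
   band matters, and every finite measure there arises from some right-continuous
   nondecreasing F, mass at the left endpoint -L being the jump of F at -L. *)
Definition bandlimited (B : R -> R) (L : R) : Prop :=
  exists F : cumulative R R, forall s : R,
    ((B s)%:C)%C =
    complex_integral (lebesgue_stieltjes_measure F) `[- L, L[
      (fun l => expi (s * l)).

End bandlimited.

Section sampling.
Context {R : realType} {Omega : Type}.

Definition sinc (x : R) : R := if x == 0 then 1 else sin x / x.

(* The index j ranges over 0, ..., 2n and encodes k = j - n. *)
Definition sampling_sum (X : R -> Omega -> R) (omega : R) (n : nat)
    (t : R) (w : Omega) : R :=
  \sum_(j < n.*2.+1)
    let tk := (j%:R - n%:R) * pi / omega in
    sinc (omega * (t - tk)) * X tk w.

End sampling.

Section bound.
Context {R : realType}.

Definition C_bound (B : R -> R) (omega L z : R) (n : nat) (t : R) : R :=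
  B 0 * (4 * omega * t / (pi ^+ 2 * (1 - z)) +
         4 * (z + 1 + n%:R^-1) /
           (pi * (1 - z) ^+ 2 * (1 - L / omega))) ^+ 2.

Definition S_bound (B : R -> R) (CX omega L z T p : R) (n : nat) : R :=
  (CX / n%:R) `^ p *
  Rintegral lebesgue_measure `[0, T]
    (fun t => C_bound B omega L z n t `^ (p / 2)).

End bound.

(* Main.v *)
(* Write x = omega t / pi and theta = pi lambda / omega.  By the spectral
   representation, the mean square of X(t) - X_n(t) is the integral against the
   spectral measure of the squared truncation error of the interpolation series
   of exp(i x theta) at the integers.  That series converges for |theta| < pi:
   exp(-i x theta) times a partial sum has theta-derivative proportional to
   cos((n + 1/2) theta) / cos(theta / 2), whose primitives are O(1/n), so the
   limit does not depend on theta, and integrating against 1 + cos theta shows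
   that it is 1.  Pairing k with -k and summing by parts bounds the tail, hence
   tau(X(t) - X_n(t)) <= c(t) with S = int_0^T c^p.

   For the tail bound put u = (eps / S)^(1/p).  For q = l u / p >= 1,
   q (v/u)^p <= exp(l (v - u)) + (q - 1); integrating against c^p / S with
   v = |X - X_n| / c shows that the event is contained in
   {int_0^T (c^p / S) exp(l (|X - X_n| / c - u)) dt >= 1}, whose probability is at
   most 2 exp(phi(l) - l u) by Markov and Tonelli.  The hypothesis on eps says
   f(p / u) < u, so the supremum defining the transform of phi at u may be
   restricted to l >= p / u. *)
Require Import Defs.
From HB Require Import structures.
From mathcomp Require Import all_boot all_order all_algebra.
From mathcomp Require Import all_classical all_reals all_analysis.
From mathcomp Require Import measurable_realfun complex ring lra.

Set Implicit Arguments.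
Unset Strict Implicit.
Unset Printing Implicit Defensive.

Import Order.TTheory GRing.Theory Num.Theory.
Import numFieldNormedType.Exports.

Local Open Scope classical_set_scope.
Local Open Scope ring_scope.

(** * Trigonometric sums *)

Section calculus.
Context {R : realType}.
Implicit Types (f g : R -> R) (a b t x k : R).

Lemma is_derive_cos_affine a b t :
  is_derive t 1 (fun t => cos (a * t + b)) (- (a * sin (a * t + b))).
Proof.
have D : is_derive t 1 (fun t => a * t + b) a.
  have -> : (fun t => a * t + b) = ( *:%R a \o id) + cst b.
    by apply/funext => s.
  by apply: is_derive_eq; rewrite addr0 /GRing.scale /= mulr1.
have := @is_derive1_comp _ cos _ t _ _ (is_derive_cos (a * t + b)) D.
by rewrite mulNr mulrC.
Qed.

Lemma is_derive_sin_affine a b t :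
  is_derive t 1 (fun t => sin (a * t + b)) (a * cos (a * t + b)).
Proof.
have -> : (fun t => sin (a * t + b)) = (fun t => cos (a * t + (b - pi / 2))).
  by apply/funext => s; rewrite addrA cosBpihalf.
have := is_derive_cos_affine a (b - pi / 2) t.
by rewrite addrA sinBpihalf mulrN opprK.
Qed.

Lemma le_norm_increment f (df : R -> R) a b K : a <= b ->
    (forall t, a <= t <= b -> is_derive t 1 f (df t)) ->
    (forall t, a < t < b -> `|df t| <= K) ->
  `|f b - f a| <= K * (b - a).
Proof.
move=> ab fdf dfK; have [->|ab'] := eqVneq a b; first by rewrite !subrr mulr0 normr0.
have {ab'} ab' : a < b by rewrite lt_neqAle ab' ab.
have cf : {within `[a, b], continuous f}.
  by apply: derivable_within_continuous => s sab; case: (fdf s _) => //; rewrite !(itvP sab).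
have fdf' s : s \in `]a, b[ -> is_derive s 1 f (df s).
  by move=> sab; apply: fdf; rewrite !ltW ?(itvP sab).
have [c cab ->] := MVT ab' fdf' cf.
rewrite normrM (ger0_norm (_ : 0 <= b - a)) ?subr_ge0//.
by rewrite ler_wpM2r ?subr_ge0// dfK// (itvP cab).
Qed.

(** The mean value theorem gives sin t = t cos c with 0 < c < t, and the cosine decreases there. *)
Lemma sin_ge_mulcos t : 0 <= t <= pi / 2 -> t * cos t <= sin t.
Proof.
move=> /andP[t0 tpi].
have csin : {within `[0, t], continuous (@sin R)}.
  by apply: continuous_subspaceT; exact: continuous_sin.
have [<-|t0'] := eqVneq 0 t; first by rewrite mul0r sin0.
have {t0'} t0' : 0 < t by rewrite lt_neqAle t0' t0.
have [c c0t] := MVT t0' (fun s _ => is_derive_sin s) csin.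
rewrite sin0 !subr0 => ->; rewrite mulrC ler_wpM2r//.
have := @ltr_cos R; move=> /(_ c t); rewrite !in_itv /=.
have pi0 := pi_gt0 R.
have /andP[c0 ct] : 0 < c < t by rewrite !(itvP c0t).
move=> H; rewrite ltW// H//; apply/andP; split; lra.
Qed.

(** By duplication, sin t = 2 sin(t/2) cos(t/2) is at least t cos(t/2)^2, and cos(t/2)^2 >= 1/2
    because cos t >= 0 on this range. *)
Lemma sin_ge_half t : 0 <= t <= pi / 2 -> t / 2 <= sin t.
Proof.
move=> /andP[t0 tpi]; have pi0 := pi_gt0 R.
have H : t / 2 * cos (t / 2) <= sin (t / 2) by apply: sin_ge_mulcos; lra.
have c0 : 0 <= cos (t / 2) by apply: cos_ge0_pihalf; lra.
have ct0 : 0 <= cos t by apply: cos_ge0_pihalf; lra.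
have E : t = (t / 2) *+ 2 by rewrite mulr2n; lra.
have Es := sin_mulr2n (t / 2); have Ec := cos_mulr2n (t / 2).
rewrite -E in Es Ec; rewrite Es; rewrite Ec expr2 in ct0.
have : cos (t / 2) * (t / 2 * cos (t / 2)) <= cos (t / 2) * sin (t / 2).
  by rewrite ler_wpM2l.
set c := cos (t / 2) in ct0 *; set s := sin (t / 2) => H1.
have H2 : 0 <= t * ((c * c) *+ 2 - 1) by rewrite mulr_ge0.

nra.
Qed.

(** Written as sin(pi/2 - |t|/2), the cosine is bounded below linearly in the distance from |t| to
    pi; [pi >= 2] then removes pi from the constant. This keeps the denominator cos(t/2) away from 0
    on the band. *)
Lemma cos_half_ge rho t : `|t| <= pi * rho -> rho < 1 ->
  (1 - rho) / 2 <= cos (t / 2).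
Proof.
move=> tr r1; rewrite -cos_norm normrM (ger0_norm (_ : 0 <= 2^-1))//.
have pi2 := pi_ge2 R; have := normr_ge0 t; set s := `|t| in tr * => s0.
have -> : cos (s * 2^-1) = sin (pi / 2 - s / 2).
  by rewrite sinB cos_pihalf sin_pihalf mul1r mul0r subr0.
have pr : pi * rho < pi by rewrite gtr_pMr// pi_gt0.
apply: le_trans (sin_ge_half _); last lra.
have : 0 <= (pi - 2) * (1 - rho) by apply: mulr_ge0; lra.
nra.
Qed.

Lemma sincM t : sinc t * t = sin t.
Proof.
by rewrite /sinc; case: eqP => [->|/eqP t0]; rewrite ?mulr0 ?sin0// divfK.
Qed.

Lemma sincN t : sinc (- t) = sinc t.
Proof. by rewrite /sinc oppr_eq0 sinN invrN mulrNN. Qed.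

Lemma sinc_pi_nat (m : nat) : sinc (pi * m%:R) = (m == 0)%:R :> R.
Proof.
rewrite /sinc mulf_eq0 pnatr_eq0 (gt_eqF (pi_gt0 R)) /=.
case: m => [|m] //=; suff -> : sin (pi * m.+1%:R) = 0 :> R by rewrite mul0r.
elim: m => [|m IH]; first by rewrite mulr1 sinpi.
by rewrite -natr1 mulrDr mulr1 sinDpi IH oppr0.
Qed.

Lemma sin_piD_nat x n : sin (pi * (x + n%:R)) = (-1) ^+ n * sin (pi * x).
Proof.
elim: n => [|n IH]; first by rewrite addr0 mul1r.
by rewrite -natr1 addrA mulrDr mulr1 sinDpi IH exprS mulN1r mulNr.
Qed.

Lemma sin_piB_nat x n : sin (pi * (x - n%:R)) = (-1) ^+ n * sin (pi * x).
Proof.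
have := sin_piD_nat (x - n%:R) n; rewrite subrK => ->.
by rewrite mulrA -exprMn mulrNN mulr1 expr1n mul1r.
Qed.

(** Pairing k with -k makes the passage from n to n + 1 a single term, which drives the inductions
    and the tail estimates. *)
Definition symsum n g : R := g 0 + \sum_(k < n) (g k.+1%:R + g (- k.+1%:R)).

Lemma symsumS n g :
  symsum n.+1 g = symsum n g + (g n.+1%:R + g (- n.+1%:R)).
Proof. by rewrite /symsum big_ord_recr /= addrA. Qed.

Lemma symsumE n g : \sum_(j < n.*2.+1) g (j%:R - n%:R) = symsum n g.
Proof.
elim: n => [|n IH]; first by rewrite /symsum big_ord1 big_ord0 subrr addr0.
rewrite symsumS -IH doubleS -!(big_mkord xpredT (fun j => g (j%:R - _))).
rewrite big_nat_recl// big_nat_recr//= sub0r.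
have -> : n.*2.+2%:R - n.+1%:R = n.+1%:R :> R.
  by rewrite -addnn -addSn -addnS natrD addrK.
rewrite [LHS]addrC -[LHS]addrA; congr (_ + _).
by apply: eq_bigr => i _; rewrite -!natr1 opprD addrACA subrr addr0.
Qed.

Lemma eq_symsum n g1 g2 : g1 =1 g2 -> symsum n g1 = symsum n g2.
Proof. by move=> E; rewrite /symsum E; under eq_bigr do rewrite !E. Qed.

Lemma symsumD n g1 g2 :
  symsum n (fun k => g1 k + g2 k) = symsum n g1 + symsum n g2.
Proof.
elim: n => [|n IH]; first by rewrite /symsum !big_ord0; lra.
by rewrite !symsumS IH; lra.
Qed.

Lemma symsumZ n a g : symsum n (fun k => a * g k) = a * symsum n g.
Proof.
elim: n => [|n IH]; first by rewrite /symsum !big_ord0; lra.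
by rewrite !symsumS IH; lra.
Qed.

Lemma is_derive_symsum n (G dG : R -> R -> R) t :
    (forall k, is_derive t 1 (G k) (dG k t)) ->
  is_derive t 1 (fun t => symsum n (G^~ t)) (symsum n (dG^~ t)).
Proof.
move=> GD; elim: n => [|n IH].
  rewrite /symsum !big_ord0 addr0.
  by under eq_fun do rewrite big_ord0 addr0; exact: GD.
rewrite symsumS; under eq_fun do rewrite symsumS.
by apply: is_deriveD; apply: is_deriveD.
Qed.

End calculus.

(** * Interpolation sums with the phase factored out *)

Section wave.
Context {R : realType}.
Implicit Types (b t x k : R).

(* For [b = 0] and [b = - (pi / 2)], the real and imaginary parts of
   exp(-i x t) times the partial sum of the interpolation series of exp(i x t). *)
Definition wave x b n t : R :=
  symsum n (fun k => sinc (pi * (x - k)) * cos ((k - x) * t + b)).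

(** Differentiation brings out the factor [k - x], which cancels the denominator of the sinc: a
    plain trigonometric sum remains. *)
Lemma is_derive_wave x b n t : is_derive t 1 (wave x b n)
  (pi^-1 * symsum n (fun k => sin (pi * (x - k)) * sin ((k - x) * t + b))).
Proof.
have pi0 : pi != 0 :> R by rewrite gt_eqF// pi_gt0.
rewrite -symsumZ.
apply: (is_derive_symsum n
  (G := fun k t => sinc (pi * (x - k)) * cos ((k - x) * t + b))
  (dG := fun k t => pi^-1 * (sin (pi * (x - k)) * sin ((k - x) * t + b)))) => k.
have -> : pi^-1 * (sin (pi * (x - k)) * sin ((k - x) * t + b)) =
    sinc (pi * (x - k)) *: - ((k - x) * sin ((k - x) * t + b)).
  rewrite -sincM /GRing.scale /=.
  by move: (pi : R) pi0 => p p0; field.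
exact: (is_deriveZ (f := fun t => cos ((k - x) * t + b)) _
  (is_derive_cos_affine (k - x) b t)).
Qed.

(** Since sin(pi (x - k)) = (-1)^k sin(pi x), this is an alternating Dirichlet kernel; the factor
    cos(t/2) makes the sum telescope. *)
Lemma dirichlet_kernel x b n t :
  symsum n (fun k => sin (pi * (x - k)) * sin ((k - x) * t + b)) * cos (t / 2) =
  - (sin (pi * x) * sin (x * t - b) * ((-1) ^+ n * cos ((n%:R + 2^-1) * t))).
Proof.
elim: n => [|n IH].
  rewrite /symsum big_ord0 addr0 subr0 sub0r expr0 mul1r add0r (mulrC 2^-1).
  have -> : - x * t + b = - (x * t - b) by ring.
  by rewrite sinN; ring.
rewrite symsumS mulrDl IH opprK sin_piB_nat sin_piD_nat.
have -> : (n%:R + 2^-1) * t = n.+1%:R * t - t / 2 by rewrite -natr1; field.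
have -> : (n.+1%:R + 2^-1) * t = n.+1%:R * t + t / 2 by field.
have -> : (n.+1%:R - x) * t + b = n.+1%:R * t - (x * t - b) by ring.
have -> : (- n.+1%:R - x) * t + b = - (n.+1%:R * t) - (x * t - b) by ring.
rewrite !sinB !cosD !sinN !cosN exprS.
ring.
Qed.

Lemma wave0 x b n : wave x b n 0 = cos b * symsum n (fun k => sinc (pi * (x - k))).
Proof. by rewrite -symsumZ; apply: eq_symsum => k; rewrite mulr0 add0r mulrC. Qed.

Lemma waveN x b n t : wave x b n (- t) = wave x (- b) n t.
Proof.
by apply: eq_symsum => k; rewrite mulrN -[in LHS]cosN opprD opprK.
Qed.

(* Integration by parts, in mean value form, for the oscillating derivative. *)
Lemma wave_sub0_pos x b n t : 0 <= t < pi ->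
  `|wave x b n t - cos b * symsum n (fun k => sinc (pi * (x - k)))|
    * cos (t / 2) ^+ 2 <= (`|x| + 2) / (n%:R + 2^-1).
Proof.
move=> /andP[t0 tpi]; have pi0 := pi_gt0 R; have pi2 := pi_ge2 R.
set q : R := n%:R + 2^-1; have q0 : 0 < q by rewrite ltr_wpDl.
set c := cos (t / 2).
have cs s : 0 <= s <= t -> c <= cos (s / 2).
  move=> /andP[s0 st]; have [->//|ns] := eqVneq s t.
  have {ns} st' : s < t by rewrite lt_neqAle ns st.
  have := @ltr_cos R (s / 2) (t / 2); rewrite !in_itv /= => H.
  rewrite /c ltW// H; first lra; apply/andP; split; lra.
have c0 : 0 < c by apply: cos_gt0_pihalf; lra.
have c1 : c <= 1 by apply: cos_le1.
pose r := (-1) ^+ n * sin (pi * x) / (pi * q).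
have r1 : `|r| * (pi * q) <= 1.
  rewrite -[X in _ * X]gtr0_norm ?mulr_gt0// -normrM /r divfK ?gt_eqF ?mulr_gt0//.
  by rewrite normrM normrX normrN1 expr1n mul1r sin_max.
(* [h] integrates only the fast factor cos(q s). Its leading derivative cancels that of [wave], and
   the remainder [dh] keeps the factor [r], of order 1/q. *)
pose h s := r * (sin (x * s - b) * (sin (q * s) * (cos (s / 2))^-1)).
pose dh s := r * sin (q * s) *
  (x * cos (x * s - b) / cos (s / 2) +
   2^-1 * sin (x * s - b) * sin (s / 2) / cos (s / 2) ^+ 2).
have Hd s : 0 <= s <= t -> is_derive s 1 (fun s => wave x b n s + h s) (dh s).
  move=> st; have cs0 : cos (s / 2) != 0 by rewrite gt_eqF// (lt_le_trans c0)// cs.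
  have Dc : is_derive s 1 (fun s => (cos (s / 2))^-1)
      (- (cos (s / 2)) ^- 2 * - (2^-1 * sin (s / 2))).
    have := is_derive_cos_affine (2^-1) 0 s.
    under eq_fun do rewrite addr0 mulrC.
    rewrite addr0 (mulrC _ s) => D.
    by have := is_deriveV (f := fun s => cos (s / 2)) cs0; apply.
  have Dq : is_derive s 1 (fun s => sin (q * s)) (q * cos (q * s)).
    have := is_derive_sin_affine q 0 s.
    by under eq_fun do rewrite addr0; rewrite addr0.
  have Dx := is_derive_sin_affine x (- b) s.
  have D1 := is_deriveM (f := fun s => sin (q * s)) Dq Dc.
  have D2 := is_deriveM (f := fun s => sin (x * s - b)) Dx D1.
  have D3 := is_deriveZ r D2.
  have D4 := is_deriveD (f := wave x b n) (is_derive_wave x b n s) D3.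
  apply: (is_derive_eq (df := _) D4) => {D1 D2 D3 D4 Dx Dq Dc}.
  have := dirichlet_kernel x b n s; rewrite -/q => /(canRL (mulfK cs0)) ->.
  rewrite /dh /r /GRing.scale /=.
  move: (pi : R) pi0 => p p0; rewrite !fctE; field.
  by rewrite cs0 !gt_eqF.
(* All inverse powers of cos(s/2) are weakened to c^-2, using c <= cos(s/2) and c <= 1. *)
have dhK s : 0 < s < t -> `|dh s| <= (`|x| + 1) / (pi * q) / c ^+ 2.
  move=> /andP[s0 st]; have ccs : c <= cos (s / 2) by apply: cs; rewrite !ltW.
  have cs0 := lt_le_trans c0 ccs.
  have Vc : (cos (s / 2))^-1 <= c^-1 by rewrite lef_pV2.
  have c1V : 1 <= c^-1 by rewrite invf_ge1.
  have c0V : 0 <= c^-1 by rewrite invr_ge0 ltW.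
  have Vs : 0 <= (cos (s / 2))^-1 by rewrite invr_ge0 ltW.
  have Vc2 : (cos (s / 2))^-1 * (cos (s / 2))^-1 <= c^-1 * c^-1.
    by apply: ler_pM.
  have Vc3 : (cos (s / 2))^-1 <= c^-1 * c^-1.
    by apply: (le_trans Vc); rewrite ler_peMl.
  have -> : (`|x| + 1) / (pi * q) / c ^+ 2 =
      (pi * q)^-1 * (`|x| * (c^-1 * c^-1) + c^-1 * c^-1).
    by move: (pi : R) pi0 => p p0; field; rewrite !gt_eqF.
  rewrite /dh normrM ler_pM//.
    rewrite normrM -[leRHS]mulr1 ler_pM// ?sin_max//.
    by rewrite -[leRHS]mul1r ler_pdivlMr ?mulr_gt0.
  apply: (le_trans (ler_normD _ _)); rewrite lerD//.
    rewrite !normrM (ger0_norm Vs) -mulrA ler_wpM2l//.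
    by rewrite -[leRHS]mul1r ler_pM// cos_max.
  rewrite expr2 invfM !normrM !(ger0_norm Vs) -[leRHS]mul1r ler_pM// ?mulr_ge0//.
  rewrite (ger0_norm (_ : 0 <= 2^-1))// -mulrA.
  have := ler_pM (normr_ge0 _) (normr_ge0 _) (sin_max (x * s - b)) (sin_max (s / 2)).
  rewrite mulr1; lra.
have := le_norm_increment t0 Hd dhK.
rewrite wave0 /h !mulr0 sin0 mul0r !mulr0 addr0 subr0 => Hinc.
rewrite -/(h t) in Hinc.
set W := wave x b n t in Hinc *; set s0 := cos b * _ in Hinc *.
have hb : `|h t| <= (pi * q)^-1 * c^-1.
  rewrite /h normrM ler_pM// ?mulr_ge0//.
    by rewrite -[leRHS]mul1r ler_pdivlMr ?mulr_gt0.
  rewrite normrM -[leRHS]mul1r ler_pM// ?sin_max//.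
  rewrite normrM -[leRHS]mul1r ler_pM// ?sin_max//.
  by rewrite -/c gtr0_norm// invr_gt0.
have : `|W - s0| <= (`|x| + 1) / (pi * q) / c ^+ 2 * t + (pi * q)^-1 * c^-1.
  have -> : W - s0 = (W + h t - s0) - h t by ring.
  by apply: (le_trans (ler_normB _ _)); exact: lerD.
move=> Hfin.
have c20 : 0 < c ^+ 2 by rewrite exprn_gt0.
apply: (le_trans (ler_wpM2r (ltW c20) Hfin)).
have -> : ((`|x| + 1) / (pi * q) / c ^+ 2 * t + (pi * q)^-1 * c^-1) * c ^+ 2 =
  ((`|x| + 1) * (t / pi) + c / pi) / q.
  by move: (pi : R) pi0 => p' p0; field; rewrite !gt_eqF.
rewrite ler_pM2r ?invr_gt0//.
have x0 := normr_ge0 x.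
have : (`|x| + 1) * (t / pi) <= (`|x| + 1) * 1.
  by rewrite ler_wpM2l ?addr_ge0// ler_pdivrMr// mul1r ltW.
have : c / pi <= 1 by rewrite ler_pdivrMr// mul1r; lra.
lra.
Qed.

Lemma wave_sub0 x b n t : - pi < t < pi ->
  `|wave x b n t - cos b * symsum n (fun k => sinc (pi * (x - k)))|
    * cos (t / 2) ^+ 2 <= (`|x| + 2) / (n%:R + 2^-1).
Proof.
move=> /andP[ta tb]; have [t0|t0] := leP 0 t; first by rewrite wave_sub0_pos ?t0.
have := @wave_sub0_pos x (- b) n (- t).
by rewrite waveN opprK cosN mulNr cosN; apply; rewrite oppr_ge0 ltW// ltrNl.
Qed.

End wave.

(** * Convergence of the interpolation series *)

Section wave_limit.
Context {R : realType}.
Implicit Types (b t x k m : R).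

(** The primitive sin(m t)/m of cos(m t), in a form that also covers m = 0. *)
Lemma is_derive_mul_sinc m t :
  is_derive t 1 (fun t => t * sinc (m * t)) (cos (m * t)).
Proof.
have [->|m0] := eqVneq m 0.
  rewrite mul0r cos0; under eq_fun do rewrite mul0r /sinc eqxx mulr1.
  exact: is_derive_id.
have -> : (fun t => t * sinc (m * t)) = m^-1 *: (fun t => sin (m * t + 0)).
  apply/funext => s; rewrite fctE addr0 -sincM /GRing.scale /=.
  by field.
have := is_deriveZ m^-1 (is_derive_sin_affine m 0 t).
by rewrite addr0 /GRing.scale /= mulrA mulVf// mul1r.
Qed.

(* The primitive of (1 + cos t) cos (k t) vanishing at 0. *)
Definition moment k t : R := t * sinc (k * t) +
  2^-1 * (t * sinc ((k + 1) * t) + t * sinc ((k - 1) * t)).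

Lemma is_derive_moment k t :
  is_derive t 1 (moment k) ((1 + cos t) * cos (k * t)).
Proof.
have D0 := is_derive_mul_sinc k t.
have D1 := is_derive_mul_sinc (k + 1) t.
have D2 := is_derive_mul_sinc (k - 1) t.
have D3 := is_deriveZ 2^-1 (is_deriveD D1 D2).
apply: (is_derive_eq (is_deriveD D0 D3)).
by rewrite /GRing.scale /= mulrBl mulrDl mul1r cosD cosB; field.
Qed.

Lemma momentN k t : moment (- k) t = moment k t.
Proof.
rewrite /moment; have -> : (- k + 1) * t = - ((k - 1) * t) by ring.
have -> : (- k - 1) * t = - ((k + 1) * t) by ring.
by rewrite mulNr !sincN (addrC (t * sinc ((k - 1) * t))).
Qed.

Lemma moment_nat (j : nat) : moment j.+1%:R pi = (j == 0%N)%:R * (pi / 2).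
Proof.
rewrite /moment natr1 -[j.+1%:R - 1]/(_) -{2}natr1 addrK !(mulrC _ pi).
by rewrite !sinc_pi_nat /= !mulr0 !add0r mulrA (mulrC 2^-1); ring.
Qed.

Lemma moment0 : moment 0 pi = pi.
Proof.
rewrite /moment add0r sub0r mulNr sincN mul0r.
have := sinc_pi_nat (R := R) 1; rewrite mulr1 mul1r => ->.
by rewrite /sinc eqxx !mulr0 addr0 mulr0 addr0 mulr1.
Qed.

(** Orthogonality of the cosines on [0, pi]: the weight 1 + cos t only sees the frequencies 0, 1 and
    -1. *)
Lemma symsum_moment x n : (0 < n)%N ->
  symsum n (fun k => sinc (pi * (x - k)) * moment k pi) =
  pi * (sinc (pi * (x - 0)) + 2^-1 * (sinc (pi * (x - 1)) + sinc (pi * (x - (- 1))))).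
Proof.
elim: n => // -[|n] IH _.
  rewrite /symsum big_ord1 /= moment0 momentN !moment_nat /=.
  by move: (sinc (pi * (x - 0))) (sinc (pi * (x - 1))) (sinc (pi * (x - (- 1)))) => u v w; field.
by rewrite symsumS IH// momentN !moment_nat /= !mul0r !mulr0 !addr0.
Qed.

(** Splitting k t = (k - x) t + x t restores the phase: this sum and the sine sum below are the two
    waves rotated by the angle x t. *)
Lemma cos_sum_wave x n t :
  symsum n (fun k => sinc (pi * (x - k)) * cos (k * t)) =
  cos (x * t) * wave x 0 n t - sin (x * t) * wave x (- (pi / 2)) n t.
Proof.
rewrite /wave -!symsumZ -[- symsum _ _]mulN1r -symsumZ -symsumD; apply: eq_symsum => k /=.
rewrite addr0 cosBpihalf; have -> : k * t = (k - x) * t + x * t by ring.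
by rewrite cosD; ring.
Qed.

Lemma sin_sum_wave x n t :
  symsum n (fun k => sinc (pi * (x - k)) * sin (k * t)) =
  sin (x * t) * wave x 0 n t + cos (x * t) * wave x (- (pi / 2)) n t.
Proof.
rewrite /wave -!symsumZ -symsumD; apply: eq_symsum => k /=.
rewrite addr0 cosBpihalf; have -> : k * t = (k - x) * t + x * t by ring.
by rewrite sinD; ring.
Qed.

(** The interpolation sum of the constant 1, that is, [wave x 0 n] at t = 0. *)
Definition sinc_sum x n : R := symsum n (fun k => sinc (pi * (x - k))).

(** It measures, against the weight 1 + cos t, how far the cosine sum is from [sinc_sum] times cos(x
    t). *)
Definition primitive x n t : R :=
  symsum n (fun k => sinc (pi * (x - k)) * moment k t) - sinc_sum x n * moment x t.

Lemma is_derive_primitive x n t : is_derive t 1 (primitive x n)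
  ((1 + cos t) * (symsum n (fun k => sinc (pi * (x - k)) * cos (k * t)) - sinc_sum x n * cos (x * t))).
Proof.
have D1 := @is_derive_symsum R n (fun k t => sinc (pi * (x - k)) * moment k t)
  (fun k t => sinc (pi * (x - k)) * ((1 + cos t) * cos (k * t))) t
  (fun k => is_deriveZ (sinc (pi * (x - k))) (is_derive_moment k t)).
have D2 := is_deriveZ (sinc_sum x n) (is_derive_moment x t).
apply: (is_derive_eq (is_deriveB D1 D2)).
rewrite /GRing.scale /= mulrBr -symsumZ mulrCA; congr (_ - _).
by apply: eq_symsum => k; rewrite mulrCA.
Qed.

(** The integrand is O(1/n) uniformly up to pi, although cos(t/2) vanishes there: the weight 1 + cos
    t = 2 cos(t/2)^2 supplies exactly the factor in [wave_sub0]. *)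
Lemma primitive_bound x n :
  `|primitive x n pi| <= pi * (4 * ((`|x| + 2) / (n%:R + 2^-1))).
Proof.
have pi0 := pi_gt0 R; set K := (`|x| + 2) / _.
have m0 k : moment k 0 = 0 by rewrite /moment !mul0r addr0 mulr0 addr0.
have P0 : primitive x n 0 = 0.
  rewrite /primitive m0 mulr0 subr0 -[RHS](mul0r (symsum n (fun=> 0))) -symsumZ.
  by apply: eq_symsum => k; rewrite m0 mulr0 mul0r.
rewrite -[primitive x n pi]subr0 -[X in _ - X]P0.
have -> : pi * (4 * K) = 4 * K * (pi - 0) by rewrite subr0 mulrC.
apply: (le_norm_increment (ltW pi0) (fun t _ => is_derive_primitive x n t)) => t.
move=> /andP[t0 tpi]; rewrite cos_sum_wave.
have tt : - pi < t < pi by lra.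
have := wave_sub0 x 0 n tt; have := wave_sub0 x (- (pi / 2)) n tt.
rewrite cosN cos_pihalf mul0r subr0 cos0 mul1r -/(sinc_sum x n) -/K.
have := cos_mulr2n (t / 2); have -> : (t / 2) *+ 2 = t by rewrite mulr2n; lra.
move=> ->; set U := wave x 0 n t; set V := wave x _ n t.
set c2 := cos (t / 2) ^+ 2 => HV HU.
have c20 : 0 <= c2 by rewrite sqr_ge0.
have -> : (1 + (c2 *+ 2 - 1)) *
    (cos (x * t) * U - sin (x * t) * V - sinc_sum x n * cos (x * t)) =
  2 * (cos (x * t) * ((U - sinc_sum x n) * c2) - sin (x * t) * (V * c2)) by ring.
rewrite normrM (ger0_norm (_ : 0 <= 2))//.
have -> : 4 * K = 2 * (1 * K + 1 * K) by ring.
rewrite ler_wpM2l//; apply: (le_trans (ler_normB _ _)).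
by rewrite lerD// normrM ler_pM// ?cos_max ?sin_max// normrM (ger0_norm c20).
Qed.

Lemma symsum_sinc_nat (m n : nat) : (m <= n)%N -> sinc_sum m%:R n = 1.
Proof.
move=> mn; suff H j : sinc_sum m%:R j = (m <= j)%:R by rewrite H mn.
elim: j => [|j IH].
  by rewrite /sinc_sum /symsum big_ord0 addr0 subr0 sinc_pi_nat leqn0.
rewrite /sinc_sum symsumS -/(sinc_sum _ j) IH opprK -natrD sinc_pi_nat addnS /= addr0.
have -> : sinc (pi * (m%:R - j.+1%:R)) = (m == j.+1)%:R :> R.
  have [mj|mj] := leqP m j.+1.
    rewrite -sincN -mulrN opprB -natrB// sinc_pi_nat subn_eq0.
    by rewrite eqn_leq mj.
  by rewrite -natrB ?(ltnW mj)// sinc_pi_nat subn_eq0 leqNgt mj gtn_eqF.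
rewrite (leq_eqVlt m j.+1) ltnS -natrD.
by case: eqVneq => [->|_]; rewrite ?ltnn ?addn0.
Qed.

(** At t = pi the cosine sum and the moment of x reduce to the same expression [pi * - r], so
    [primitive] is pi (-r) (1 - sinc_sum). Dividing by [r], nonzero since x is not an integer, turns
    [primitive_bound] into the claim. *)
Lemma symsum_sinc_bound x n : (0 < n)%N -> sin (pi * x) != 0 ->
  `|1 - sinc_sum x n| <= `|4 * (`|x| + 2) * (pi * x * (x ^+ 2 - 1) / sin (pi * x))|
     / (n%:R + 2^-1).
Proof.
move=> n0 sx; have pi0 := pi_gt0 R.
have x0 : x != 0 by apply: contraNneq sx => ->; rewrite mulr0 sin0.
have x1 : x - 1 != 0.
  by apply: contraNneq sx => /subr0_eq ->; rewrite mulr1 sinpi.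
have xN1 : x + 1 != 0.
  by apply: contraNneq sx => /eqP; rewrite addr_eq0 => /eqP ->; rewrite mulrN1 sinN sinpi oppr0.
have aE k : x - k != 0 -> sinc (pi * (x - k)) = sin (pi * (x - k)) / (pi * (x - k)).
  by move=> xk; rewrite -sincM mulfK// mulf_neq0// gt_eqF.
(* Partial fractions: 1/x - (1/(x - 1) + 1/(x + 1))/2 = -1/(x (x^2 - 1)). *)
have A : sinc (pi * (x - 0)) + 2^-1 * (sinc (pi * (x - 1)) + sinc (pi * (x - (- 1)))) =
    - (sin (pi * x) / (pi * x * (x ^+ 2 - 1))).
  have x2 : x ^+ 2 - 1 != 0 by rewrite -[1](expr1n _ 2) subr_sqr mulf_neq0.
  rewrite !aE ?subr0 ?opprK//.
  have := sin_piB_nat x 1; have := sin_piD_nat x 1; rewrite expr1 !mulN1r => -> ->.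
  move: (sin (pi * x)) => S; move: (pi : R) pi0 => p p0; field.
  by rewrite x0 x1 xN1 x2 gt_eqF.
have := primitive_bound x n; rewrite {1}/primitive symsum_moment// A.
have -> : moment x pi = pi * (sinc (pi * (x - 0)) + 2^-1 * (sinc (pi * (x - 1)) + sinc (pi * (x - (- 1))))).
  by rewrite /moment subr0 opprK !(mulrC _ pi); ring.
rewrite A; set r := _ / _.
have -> : pi * - r - sinc_sum x n * (pi * - r) = pi * (- r * (1 - sinc_sum x n)) by ring.
rewrite normrM (gtr0_norm pi0) ler_pM2l// normrM normrN.
have r0 : 0 < `|r|.
  rewrite normr_gt0 /r mulf_neq0// invr_eq0 !mulf_neq0//; first by rewrite gt_eqF.
  by rewrite -[1](expr1n _ 2) subr_sqr mulf_neq0.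
have -> : pi * x * (x ^+ 2 - 1) / sin (pi * x) = r^-1 by rewrite /r invf_div.
rewrite mulrC -ler_pdivlMr// => /le_trans; apply.
have x2 : 0 <= 4 * (`|x| + 2) by rewrite mulr_ge0 ?addr_ge0.
by rewrite (normrM _ r^-1) normfV (ger0_norm x2) mulrA mulrAC.
Qed.

Lemma cvg_div_nat (K : R) : K / (n%:R + 2^-1) @[n --> \oo] --> (0 : R).
Proof.
rewrite -(mulr0 K); apply: cvgMr; apply/gtr0_cvgV0.
  by apply: nearW => n; rewrite ltr_wpDl.
exact: (cvg_comp _ _ cvgr_idn (cvg_addrr _)).
Qed.

Lemma cvg_sinc_sum x : 0 <= x -> sinc_sum x n @[n --> \oo] --> (1 : R).
Proof.
move=> x0; have [sx|sx] := eqVneq (sin (pi * x)) 0; last first.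
  apply/cvgrPdist_le => e e0.
  have := cvg_div_nat `|4 * (`|x| + 2) * (pi * x * (x ^+ 2 - 1) / sin (pi * x))|.
  move=> /cvgr0_norm_le /(_ _ e0) H.
  near=> n; apply: le_trans (symsum_sinc_bound (n := n) _ sx) _.
    by near: n; exact: nbhs_infty_gt.
  by apply: le_trans (ler_norm _) _; near: n; exact: H.
(* Here x is an integer: a positive fractional part times pi would lie in ]0, pi[, where the sine is
   positive. *)
have -> : x = (Num.truncn x)%:R.
  have /andP[] := truncn_itv x0; set m := Num.truncn x => mx xm.
  apply/eqP; rewrite eq_le mx andbT leNgt; apply/negP => mx'.
  have : 0 < sin (pi * (x - m%:R)).
    rewrite sin_gt0_pi// mulr_gt0 ?pi_gt0 ?subr_gt0//= gtr_pMr ?pi_gt0//.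
    by rewrite ltrBlDl natr1.
  by rewrite sin_piB_nat sx mulr0 ltxx.
apply: cvg_near_cst; near=> n; apply/symsum_sinc_nat.
by near: n; exact: nbhs_infty_ge.
Unshelve. all: by end_near. Qed.

(** By [wave_sub0] the limit is the same as at t = 0, where the wave is cos b times [sinc_sum]. *)
Lemma cvg_wave x b t : 0 <= x -> - pi < t < pi ->
  wave x b n t @[n --> \oo] --> cos b.
Proof.
move=> x0 tpi; set c2 := cos (t / 2) ^+ 2.
have c20 : 0 < c2 by rewrite exprn_gt0// cos_gt0_pihalf//; lra.
have W0 : wave x b n t - cos b * sinc_sum x n @[n --> \oo] --> (0 : R).
  apply/cvgr0Pnorm_le => e e0.
  have := cvg_div_nat (`|x| + 2); move=> /cvgr0_norm_le /(_ (e * c2)).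
  rewrite mulr_gt0// => /(_ isT) H; near=> n.
  rewrite -(ler_pM2r c20); apply: le_trans (wave_sub0 x b n tpi) _.
  by apply: le_trans (ler_norm _) _; near: n; exact: H.
have -> : (fun n => wave x b n t) =
    (fun n => wave x b n t - cos b * sinc_sum x n) +
    (cst (cos b) \* sinc_sum x).
  by apply/funext => n; rewrite !fctE subrK.
rewrite -[X in _ --> X]add0r; apply: (cvgD W0).
rewrite -[X in _ --> X]mulr1; apply: (cvgM (cvg_cst _)).
exact: cvg_sinc_sum.
Unshelve. all: by end_near. Qed.

End wave_limit.

(** * Truncation error *)

Section sampling_error.
Context {R : realType}.
Implicit Types (t x z rho : R).

Lemma abel_sum_le (u g : nat -> R) m :
    (forall k, `|u k| <= 1) -> (forall k, 0 <= g k.+1 <= g k) ->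
  `|\sum_(k < m) (u k.+1 - u k) * g k| <= 2 * g 0.
Proof.
move=> u1 gd.
have g0 k : 0 <= g k by have /andP[a b] := gd k; exact: le_trans b.
(* Summation by parts as an induction: with the boundary term [u 0 * g 0] included, the estimate is
   stable under shifting both sequences. *)
have H : `|\sum_(k < m) (u k.+1 - u k) * g k + u 0 * g 0| <= g 0.
  elim: m u g u1 gd g0 => [|m IH] u g u1 gd g0.
    by rewrite big_ord0 add0r normrM (ger0_norm (g0 0)) ler_piMl ?u1.
  rewrite big_ord_recl /=.
  have := IH (fun k => u k.+1) (fun k => g k.+1)
    (fun k => u1 k.+1) (fun k => gd k.+1) (fun k => g0 k.+1).
  under [in X in X -> _]eq_bigr do rewrite -/(bump 0 _).
  set T := \sum_(i < m) _; rewrite -[in X in _ -> X]/T => HT.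
  have -> : (u 1 - u 0) * g 0 + T + u 0 * g 0 =
    u 1 * (g 0 - g 1) + (T + u 1 * g 1) by ring.
  apply: (le_trans (ler_normD _ _)).
  have -> : g 0 = (g 0 - g 1) + g 1 by ring.
  rewrite lerD// addrK normrM.
  have /andP[_ g10] := gd 0; rewrite -subr_ge0 in g10.
  by rewrite (ger0_norm g10) ler_piMl.
set T := \sum_(k < m) _ in H *.
have -> : T = (T + u 0 * g 0) - u 0 * g 0 by ring.
apply: (le_trans (ler_normB _ _)); rewrite mulr_natl mulr2n lerD//.
by rewrite normrM (ger0_norm (g0 0)) ler_piMl ?u1.
Qed.

Lemma symsum_add n m (g : R -> R) : symsum (n + m) g =
  symsum n g + \sum_(k < m) (g (n + k).+1%:R + g (- (n + k).+1%:R)).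
Proof.
elim: m => [|m IH]; first by rewrite addn0 big_ord0 addr0.
by rewrite addnS symsumS IH big_ord_recr /= -addrA.
Qed.

Variables (x z : R) (n : nat).
Hypotheses (x0 : 0 <= x) (z1 : z < 1) (xz : x ^+ 2 <= z * n%:R ^+ 2) (n0 : (0 < n)%N).

Let n0R : 0 < n%:R :> R. Proof. by rewrite ltr0n. Qed.

(** x^2 <= z n^2 <= z j^2: the omitted nodes stay away from x. *)
Lemma tail_denominator j : (n <= j)%N -> (1 - z) * j%:R ^+ 2 <= j%:R ^+ 2 - x ^+ 2.
Proof.
move=> nj; rewrite mulrBl mul1r lerB//; apply: (le_trans xz).
have z0 : 0 <= z.
  by rewrite -(pmulr_lge0 _ (exprn_gt0 2 n0R)); apply: le_trans xz; exact: sqr_ge0.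
by rewrite ler_wpM2l// ler_pXn2r ?nnegrE// ler_nat.
Qed.

Lemma tail_denominator_gt0 j : (n <= j)%N -> 0 < j%:R ^+ 2 - x ^+ 2.
Proof.
move=> nj; apply: lt_le_trans (tail_denominator nj).
by rewrite mulr_gt0 ?subr_gt0// exprn_gt0// ltr0n (leq_trans n0).
Qed.

Let tail_neq j : (n <= j)%N -> (x - j%:R != 0) /\ (x + j%:R != 0).
Proof.
move=> /tail_denominator_gt0; rewrite subr_sqr => H; split; apply: contraTneq H.
  by move=> /subr0_eq ->; rewrite subrr mul0r ltxx.
by rewrite (addrC x) => ->; rewrite mulr0 ltxx.
Qed.

(** For cosines the pair j, -j carries 1/(x - j) + 1/(x + j) = 2 x/(x^2 - j^2), which is
    quadratically small; comparison with 1/(j (j - 1)) = 1/(j - 1) - 1/j gives a telescoping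
    bound. *)
Lemma cos_tail t m :
  `|\sum_(k < m) (sinc (pi * (x - (n + k).+1%:R)) * cos ((n + k).+1%:R * t) +
     sinc (pi * (x - - (n + k).+1%:R)) * cos (- (n + k).+1%:R * t))|
  <= 2 * x / (pi * (1 - z)) * (n%:R^-1 - (n + m)%:R^-1).
Proof.
have pi0 := pi_gt0 R.
elim: m => [|m IH]; first by rewrite big_ord0 addn0 subrr mulr0 normr0.
rewrite big_ord_recr /=; apply: (le_trans (ler_normD _ _)).
have -> : n%:R^-1 - (n + m.+1)%:R^-1 =
  (n%:R^-1 - (n + m)%:R^-1) + ((n + m)%:R^-1 - (n + m.+1)%:R^-1) :> R by ring.
rewrite [leRHS]mulrDr lerD// {IH}.
have nj : (n <= (n + m).+1)%N by rewrite leqW// leq_addr.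
have i0 : 0 < (n + m)%:R :> R by rewrite ltr0n ltn_addr.
have [xj1 xj2] := tail_neq nj.
have den := tail_denominator_gt0 nj; have den' := tail_denominator nj.
rewrite addnS; move: (n + m)%N i0 nj xj1 xj2 den den' => i i0 nj xj1 xj2 den den'.
rewrite opprK mulNr cosN -mulrDl normrM.
have -> : sinc (pi * (x - i.+1%:R)) + sinc (pi * (x + i.+1%:R)) =
    (-1) ^+ i.+1 * sin (pi * x) * (- (2 * x / (pi * (i.+1%:R ^+ 2 - x ^+ 2)))).
  have -> : sinc (pi * (x - i.+1%:R)) = sin (pi * (x - i.+1%:R)) / (pi * (x - i.+1%:R)).
    by rewrite -sincM mulfK// mulf_neq0// gt_eqF.
  have -> : sinc (pi * (x + i.+1%:R)) = sin (pi * (x + i.+1%:R)) / (pi * (x + i.+1%:R)).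
    by rewrite -sincM mulfK// mulf_neq0// gt_eqF.
  rewrite sin_piB_nat sin_piD_nat.
  move: (sin (pi * x)) ((-1) ^+ _) => s e; move: (pi : R) pi0 => p p0.
  move: i.+1%:R den xj1 xj2 => J den xj1 xj2; field.
  by rewrite xj1 xj2 !gt_eqF.
rewrite normrM normrM normrX normrN1 expr1n mul1r normrN.
have c0 : 0 <= 2 * x / (pi * (i.+1%:R ^+ 2 - x ^+ 2)).
  by rewrite divr_ge0 ?mulr_ge0 ?(ltW pi0) ?(ltW den).
rewrite (ger0_norm c0) -[leRHS]mul1r -[leLHS]mulrA ler_pM ?sin_max ?(mulr_ge0 c0)//.
apply: (le_trans (ler_piMr c0 (cos_max _))).
have i0' : 0 < i.+1%:R :> R by rewrite ltr0n.
have -> : i%:R^-1 - i.+1%:R^-1 = (i%:R * i.+1%:R)^-1 :> R.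
  by rewrite -natr1; field; rewrite natr1 !gt_eqF.
rewrite -[leRHS]mulrA -invfM ler_wpM2l ?mulr_ge0// lef_pV2 ?posrE ?(mulr_gt0 pi0 den) ?mulr_gt0 ?subr_gt0//.
rewrite -mulrA ler_wpM2l ?(ltW pi0)//; apply: le_trans den'.
by rewrite ler_wpM2l ?subr_ge0 ?(ltW z1)// expr2 ler_wpM2r ?(ltW i0')// ler_nat.
Qed.

(** For sines the pair carries 1/(x - j) - 1/(x + j), only O(1/j), so cancellation is needed: (-1)^j
    sin(j t) cos(t/2) is, up to a constant, the increment of the bounded sequence [u], and
    [abel_sum_le] applies with the decreasing weights [g]. *)
Lemma sin_tail rho t m : rho < 1 -> `|t| <= pi * rho ->
  `|\sum_(k < m) (sinc (pi * (x - (n + k).+1%:R)) * sin ((n + k).+1%:R * t) +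
     sinc (pi * (x - - (n + k).+1%:R)) * sin (- (n + k).+1%:R * t))|
  <= 4 / (pi * (1 - z) * (1 - rho) * n%:R).
Proof.
move=> rho1 trho; have pi0 := pi_gt0 R.
have cge := cos_half_ge trho rho1; set c := cos (t / 2) in cge.
have r0 : 0 < 1 - rho by rewrite subr_gt0.
have c0 : 0 < c by apply: lt_le_trans cge; rewrite divr_gt0.
pose u k : R := (-1) ^+ (n + k) * sin (((n + k)%:R + 2^-1) * t).
pose g k : R := (n + k).+1%:R / ((n + k).+1%:R ^+ 2 - x ^+ 2).
have -> : \sum_(k < m) (sinc (pi * (x - (n + k).+1%:R)) * sin ((n + k).+1%:R * t) +
     sinc (pi * (x - - (n + k).+1%:R)) * sin (- (n + k).+1%:R * t)) =
   - (sin (pi * x) / (pi * c)) * \sum_(k < m) (u k.+1 - u k) * g k.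
  rewrite mulr_sumr; apply: eq_bigr => k _.
  have nj : (n <= (n + k).+1)%N by rewrite leqW// leq_addr.
  have [xj1 xj2] := tail_neq nj; have den := tail_denominator_gt0 nj.
  rewrite /u /g addnS.
  move: (n + k)%N nj xj1 xj2 den => i nj xj1 xj2 den.
  have -> : (i.+1%:R + 2^-1) * t = i.+1%:R * t + t / 2 by ring.
  have -> : (i%:R + 2^-1) * t = i.+1%:R * t - t / 2 by rewrite -natr1; field.
  rewrite opprK mulNr sinN sinD sinB -/c.
  have -> : sinc (pi * (x - i.+1%:R)) = sin (pi * (x - i.+1%:R)) / (pi * (x - i.+1%:R)).
    by rewrite -sincM mulfK// mulf_neq0// gt_eqF.
  have -> : sinc (pi * (x + i.+1%:R)) = sin (pi * (x + i.+1%:R)) / (pi * (x + i.+1%:R)).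
    by rewrite -sincM mulfK// mulf_neq0// gt_eqF.
  rewrite sin_piB_nat sin_piD_nat exprS.
  move: (sin (pi * x)) ((-1) ^+ i) (sin (t / 2)) => s e sh.
  move: (sin _) (cos (_ * t)) => sj cj.
  move: (pi : R) pi0 => p p0; move: c c0 {cge} => c c0.
  move: i.+1%:R den xj1 xj2 => J den xj1 xj2; field.
  by rewrite xj1 xj2 !gt_eqF.
have u1 k : `|u k| <= 1 by rewrite normrM normrX normrN1 expr1n mul1r sin_max.
have gd k : 0 <= g k.+1 <= g k.
  have njS : (n <= (n + k.+1).+1)%N by rewrite leqW// leq_addr.
  have nj : (n <= (n + k).+1)%N by rewrite leqW// leq_addr.
  have denS := tail_denominator_gt0 njS; have den := tail_denominator_gt0 nj.
  rewrite /g divr_ge0 ?(ltW denS)//= ler_pdivrMr// mulrAC ler_pdivlMr//.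
  rewrite addnS -[(n + k).+2%:R]natr1; set J : R := (n + k).+1%:R.
  have J0 : 0 <= J by [].
  (* After cross-multiplication, the monotonicity of [g] amounts to this sum being nonnegative. *)
  rewrite -subr_ge0 [X in 0 <= X](_ : _ = J ^+ 2 + J + x ^+ 2); last by ring.
  by rewrite !addr_ge0 ?sqr_ge0.
have := abel_sum_le m u1 gd; set T := \sum_(k < m) _ => HT.
have nj : (n <= (n + 0).+1)%N by rewrite leqW// leq_addr.
have g0 : g 0 <= ((1 - z) * n%:R)^-1.
  rewrite /g; have den := tail_denominator_gt0 nj; have den' := tail_denominator nj.
  have J0 : 0 < (n + 0).+1%:R :> R by rewrite ltr0n.
  rewrite ler_pdivrMr// mulrC ler_pdivlMr ?mulr_gt0 ?subr_gt0//.
  apply: le_trans den'; rewrite mulrCA ler_wpM2l ?subr_ge0 ?(ltW z1)//.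
  by rewrite expr2 ler_wpM2l// ler_nat.
rewrite normrM normrN normrM normfV (gtr0_norm (mulr_gt0 pi0 c0)).
have s1 := sin_max (pi * x).
have -> : 4 / (pi * (1 - z) * (1 - rho) * n%:R) =
    1 / (pi * ((1 - rho) / 2)) * (2 * ((1 - z) * n%:R)^-1).
  move: (pi : R) pi0 => p p0; field; rewrite !gt_eqF ?subr_gt0//.
rewrite ler_pM//.
- by rewrite divr_ge0// ltW// mulr_gt0.
- rewrite ler_pM ?invr_ge0 ?(ltW (mulr_gt0 _ _))//.
  rewrite lef_pV2 ?posrE ?mulr_gt0 ?divr_gt0//.
  by rewrite ler_wpM2l// ltW.
- by apply: (le_trans HT); rewrite ler_wpM2l.
Qed.

(* The truncation error of the interpolation series of
   exp(i x t), with that phase factored out. *)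
Lemma wave_error rho t : rho < 1 -> `|t| <= pi * rho ->
  (1 - wave x 0 n t) ^+ 2 + wave x (- (pi / 2)) n t ^+ 2 <=
  ((2 * x / (pi * (1 - z)) + 4 / (pi * (1 - z) * (1 - rho))) / n%:R) ^+ 2.
Proof.
move=> rho1 trho; have pi0 := pi_gt0 R.
have tpi : - pi < t < pi.
  by rewrite -ltr_norml; apply: (le_lt_trans trho); rewrite gtr_pMr.
(* The two limits are cos 0 = 1 and cos(pi/2) = 0; one index [n + m] serves for both. *)
have wave_lim e : 0 < e -> exists m, 
   `|1 - wave x 0 (n + m) t| <= e /\ `|wave x (- (pi / 2)) (n + m) t| <= e.
  move=> e0; have /cvgrPdist_le/(_ _ e0) [N _ HN] := cvg_wave (b := 0) x0 tpi.
  have /cvgrPdist_le/(_ _ e0) [M _ HM] := cvg_wave (b := - (pi / 2)) x0 tpi.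
  exists (maxn N M); split.
    by rewrite -[1]cos0; apply: HN => /=; rewrite (leq_trans (leq_maxl N M))// leq_addl.
  rewrite -normrN -sub0r -cos_pihalf -cosN; apply: HM => /=.
  by rewrite (leq_trans (leq_maxr N M))// leq_addl.
set U := wave x 0 n t; set V := wave x _ n t.
(* [C] and [S] are the cosine and sine partial sums; the rotation by x t preserves the sum of
   squares. *)
pose C := cos (x * t) * U - sin (x * t) * V.
pose S := sin (x * t) * U + cos (x * t) * V.
have CS : (1 - U) ^+ 2 + V ^+ 2 = (cos (x * t) - C) ^+ 2 + (sin (x * t) - S) ^+ 2.
  have := cos2Dsin2 (x * t); rewrite /C /S.
  move: (cos _) (sin _) => a b ab.
  have -> : (a - (a * U - b * V)) ^+ 2 + (b - (b * U + a * V)) ^+ 2 =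
    (a ^+ 2 + b ^+ 2) * ((1 - U) ^+ 2 + V ^+ 2) by ring.
  by rewrite ab mul1r.
have d0 : 0 < pi * (1 - z) by rewrite mulr_gt0// subr_gt0.
(* The error is a finite tail, bounded uniformly in m, plus a remainder of size at most e for a
   suitable m. *)
have HC : `|cos (x * t) - C| <= 2 * x / (pi * (1 - z)) / n%:R.
  apply/ler_addgt0Pr => e e0; have [|m [Hu Hv]] := wave_lim (e / 2); first by rewrite divr_gt0.
  have := cos_tail t m; set T := \sum_(k < m) _ => HT.
  have ET : T = cos (x * t) * wave x 0 (n + m) t -
      sin (x * t) * wave x (- (pi / 2)) (n + m) t - C.
    by rewrite /C -!cos_sum_wave symsum_add addrAC subrr add0r.
  have -> : cos (x * t) - C = T + (cos (x * t) * (1 - wave x 0 (n + m) t) +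
      sin (x * t) * wave x (- (pi / 2)) (n + m) t) by rewrite ET; ring.
  apply: (le_trans (ler_normD _ _)); rewrite lerD//.
    apply: (le_trans HT); rewrite ler_wpM2l ?divr_ge0 ?(ltW d0) ?mulr_ge0//.
    by rewrite gerBl invr_ge0.
  have -> : e = 1 * (e / 2) + 1 * (e / 2) by field.
  by apply: (le_trans (ler_normD _ _)); rewrite lerD// normrM ler_pM// ?cos_max ?sin_max.
have HS : `|sin (x * t) - S| <= 4 / (pi * (1 - z) * (1 - rho)) / n%:R.
  apply/ler_addgt0Pr => e e0; have [|m [Hu Hv]] := wave_lim (e / 2); first by rewrite divr_gt0.
  have := sin_tail m rho1 trho; set T := \sum_(k < m) _ => HT.
  have ET : T = sin (x * t) * wave x 0 (n + m) t +
      cos (x * t) * wave x (- (pi / 2)) (n + m) t - S.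
    by rewrite /S -!sin_sum_wave symsum_add addrAC subrr add0r.
  have -> : sin (x * t) - S = T + (sin (x * t) * (1 - wave x 0 (n + m) t) -
      cos (x * t) * wave x (- (pi / 2)) (n + m) t) by rewrite ET; ring.
  apply: (le_trans (ler_normD _ _)); rewrite lerD//.
    by rewrite -mulrA -invfM.
  have -> : e = 1 * (e / 2) + 1 * (e / 2) by field.
  by apply: (le_trans (ler_normB _ _)); rewrite lerD// normrM ler_pM// ?cos_max ?sin_max.
rewrite CS -[X in X + _]real_normK ?num_real// -[X in _ + X]real_normK ?num_real//.
have := normr_ge0 (sin (x * t) - S); have := normr_ge0 (cos (x * t) - C).
move: `|cos (x * t) - C| `|sin (x * t) - S| HC HS => q r; rewrite (mulrDl _ _ n%:R^-1).
move=> qb rb q0 r0; apply: (@le_trans _ _ ((q + r) ^+ 2)); first by nra.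
have b0 := le_trans q0 qb; have b0' := le_trans r0 rb.
by rewrite ler_pXn2r ?nnegrE ?lerD//; exact: addr_ge0.
Qed.

End sampling_error.

(** * Second moments of stationary processes *)

Section mean_square.
Context {d : measure_display} {Omega : measurableType d} {R : realType}.
Variable P : probability Omega R.
Implicit Types (X : R -> Omega -> R) (B : R -> R).

Lemma integral_lincomb d' (T : measurableType d') (mu : {measure set T -> \bar R})
    (D : set T) (I : finType) (h : I -> T -> R) (c e : I -> R) :
  measurable D ->
  (forall i, mu.-integrable D (EFin \o h i)) ->
  (forall i, (\int[mu]_(x in D) (h i x)%:E = (e i)%:E)%E) ->
  mu.-integrable D (EFin \o (fun x => \sum_i c i * h i x)) /\
  (\int[mu]_(x in D) (\sum_i c i * h i x)%:E = (\sum_i c i * e i)%:E)%E.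
Proof.
move=> mD hint he.
have E : EFin \o (fun x => \sum_i c i * h i x) =
    (fun x => \sum_i ((c i)%:E * (h i x)%:E)%E).
  by apply/funext => x /=; rewrite -sumEFin.
have chint i : mu.-integrable D (fun x => (c i)%:E * (h i x)%:E)%E.
  exact: (integrableZl mD (c i) (hint i)).
rewrite [X in mu.-integrable D X /\ _]E; split; first exact: integrable_sum.
rewrite (eq_integral (fun x => \sum_i ((c i)%:E * (h i x)%:E)%E)); last first.
  by move=> x _; exact: (congr1 (@^~ x) E).
rewrite integral_sum// -sumEFin; apply: eq_bigr => i _.
by rewrite (integralZl mD (hint i)) /= he EFinM.
Qed.

Lemma double_sum (I : finType) (F : I -> I -> R) :
  \sum_i \sum_j F i j = \sum_(ij : I * I) F ij.1 ij.2.
Proof. by rewrite (pair_bigA _ F). Qed.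

Lemma sqr_sum (I : finType) (a : I -> R) :
  (\sum_i a i) ^+ 2 = \sum_i \sum_j a i * a j.
Proof. by rewrite expr2 big_distrl /=; apply: eq_bigr => i _; rewrite mulr_sumr. Qed.

(** Two expansions of the squared modulus of the sum of l_i exp(i u_i). *)
Lemma sum_cosB (I : finType) (l u : I -> R) :
  \sum_(ij : I * I) l ij.1 * l ij.2 * cos (u ij.1 - u ij.2) =
  (\sum_i l i * cos (u i)) ^+ 2 + (\sum_i l i * sin (u i)) ^+ 2.
Proof.
rewrite !sqr_sum !double_sum -big_split /=; apply: eq_bigr => -[i j] _ /=.
by rewrite cosB; ring.
Qed.

(** Finiteness of [B 0] makes each X(t) square integrable, and |a b| <= a^2 + b^2 dominates the
    product. *)
Lemma stationary_integrable X B t s : stationary P X B ->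
    (forall t, measurable_fun [set: Omega] (X t)) ->
  P.-integrable [set: Omega] (EFin \o (fun w => X t w * X s w)).
Proof.
move=> [_ XB] mX.
have sq u : P.-integrable [set: Omega] (EFin \o (fun w => X u w ^+ 2)).
  apply/integrableP; split.
    by apply/measurable_EFinP; exact: measurable_funX.
  have := XB u 0; rewrite addr0 unlock => E.
  under eq_integral do rewrite /= ger0_norm ?sqr_ge0// expr2.
  by rewrite E ltry.
apply: (le_integrable measurableT _ _ (integrableD measurableT (sq t) (sq s))).
  by apply/measurable_EFinP; exact: measurable_funM.
move=> w _ /=; rewrite lee_fin [leRHS]ger0_norm ?addr_ge0 ?sqr_ge0// ler_norml.
by apply/andP; split; nra.
Qed.

Lemma stationary_second_moment X B (I : finType) (t l : I -> R) :
    stationary P X B -> (forall t, measurable_fun [set: Omega] (X t)) ->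
  ('E_P[(fun w => (\sum_i l i * X (t i) w) ^+ 2)%R] =
   (\sum_(ij : I * I) l ij.1 * l ij.2 * B (t ij.1 - t ij.2))%:E)%E.
Proof.
move=> Xst mX; rewrite unlock.
have EB (ij : I * I) : (\int[P]_w (X (t ij.1) w * X (t ij.2) w)%:E =
    (B (t ij.1 - t ij.2))%:E)%E.
  have [_ XB] := Xst; have := XB (t ij.2) (t ij.1 - t ij.2).
  by rewrite addrCA subrr addr0 unlock.
have [_ <-] := integral_lincomb (fun ij : I * I => l ij.1 * l ij.2) measurableT
  (fun ij => stationary_integrable (t ij.1) (t ij.2) Xst mX) EB.
apply: eq_integral => w _; congr EFin; rewrite sqr_sum double_sum.
by apply: eq_bigr => ij _; ring.
Qed.

(** Taking real parts turns the spectral representation into a cosine transform of a finite measure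
    on the band. *)
Lemma bandlimitedP B L : bandlimited B L ->
  exists mu : {measure set (g_sigma_algebraType R.-ocitv.-measurable) -> \bar R},
  forall s, mu.-integrable `[(- L)%R, L[ (EFin \o (fun x => cos (s * x))) /\
    (\int[mu]_(x in `[(- L)%R, L[) (cos (s * x))%:E = (B s)%:E)%E.
Proof.
move=> [F HF]; exists (lebesgue_stieltjes_measure F) => s.
set mu : {measure set _ -> \bar R} := lebesgue_stieltjes_measure F.
(* The half-open band is enclosed in an interval open on the left, whose Stieltjes measure is an
   increment of F. *)
have muoo : (mu `[(- L)%R, L[%classic < +oo)%E.
  apply: (@le_lt_trans _ _ (mu `](- L - 1)%R, L]%classic)).
    apply: le_measure; rewrite ?inE; [exact: measurable_itv|exact: measurable_itv|].
    move=> x /=; rewrite !in_itv /= => /andP[x1 /ltW ->]; rewrite andbT.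
    by apply: lt_le_trans x1; rewrite ltrBlDr ltrDl.
  rewrite /mu /= /lebesgue_stieltjes_measure /measure_extension.
  rewrite measurable_mu_extE /=; last exact: is_ocitv.
  by rewrite wlength_itv /= -EFinB; case: ifP => _; rewrite ltry.
have icos : mu.-integrable `[(- L)%R, L[ (EFin \o (fun x => cos (s * x))).
  apply: measurable_bounded_integrable => //.
    apply: measurable_funTS; apply: continuous_measurable_fun => x.
    apply: (@continuous_comp _ _ _ (fun x => s * x) cos).
      exact: mulrl_continuous.
    exact: continuous_cos.
  exists 1; split=> // M M1 x _ /=.
  by apply: le_trans (ltW M1); exact: cos_max.
split=> //; have := HF s; rewrite /complex_integral => -[-> _].
by rewrite /Rintegral fineK//; apply: integrable_fin_num.
Qed.

(** The second moment is the spectral integral of the squared modulus of the sum of l_i exp(i t_i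
    x). Factoring out exp(i s x) leaves that modulus unchanged, and the total spectral mass is
    [B 0]. *)
Lemma second_moment_le X B L (I : finType) (t l : I -> R) s K :
    stationary P X B -> (forall t, measurable_fun [set: Omega] (X t)) ->
    bandlimited B L ->
    (forall x, `|x| <= L ->
      (\sum_i l i * cos ((t i - s) * x)) ^+ 2 +
      (\sum_i l i * sin ((t i - s) * x)) ^+ 2 <= K) ->
  ('E_P[(fun w => (\sum_i l i * X (t i) w) ^+ 2)%R] <= (K * B 0)%:E)%E.
Proof.
move=> Xst mX /bandlimitedP[mu muB] lK.
rewrite (stationary_second_moment _ _ Xst mX).
have mD : measurable (`[(- L)%R, L[%classic : set (measurableTypeR R)).
  exact: measurable_itv.
have [intl <-] := integral_lincomb (fun ij : I * I => l ij.1 * l ij.2) mD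
  (fun ij => (muB (t ij.1 - t ij.2)).1) (fun ij => (muB (t ij.1 - t ij.2)).2).
rewrite EFinM -(muB 0).2 -integralZl//; last exact: (muB 0).1.
apply: le_integral => //.
  exact: (integrableZl mD K (muB 0).1).
move=> x; rewrite inE /= in_itv /= => /andP[xL xL'].
rewrite mul0r cos0 mule1 lee_fin.
have -> : \sum_(ij : I * I) l ij.1 * l ij.2 * cos ((t ij.1 - t ij.2) * x) =
    \sum_(ij : I * I) l ij.1 * l ij.2 * cos ((t ij.1 - s) * x - (t ij.2 - s) * x).
  by apply: eq_bigr => ij _; congr (_ * cos _); ring.
by rewrite (sum_cosB l (fun i => (t i - s) * x)) lK// ler_norml xL ltW.
Qed.

End mean_square.

(** * Orlicz functions and moment generating functions *)

Section sub_gaussian_bound.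
Context {R : realType}.
Implicit Types (phi : R -> R).

(** Growth is only assumed on ]0, +oo[, so the value at 0 is reached by continuity, through a small
    positive y below x. *)
Lemma orlicz_ge0 phi x : orlicz_N_function phi -> 0 <= phi x.
Proof.
move=> [cphi phiN _ phi_lt [phi0 _ _]].
wlog x0 : x / 0 <= x.
  by move=> H; have [/H//|/ltW x0] := leP 0 x; rewrite -phiN H// oppr_ge0.
have [->|x1] := eqVneq x 0; first by rewrite phi0.
have {x0 x1} x0 : 0 < x by rewrite lt_neqAle eq_sym x1.
rewrite -phi0; apply/ler_addgt0Pr => e e0.
have := cphi 0; move=> /cvgrPdist_le /(_ _ e0) [r r0 Hr].
pose y := Num.min (x / 2) (r / 2).
have y0 : 0 < y by rewrite lt_min !divr_gt0.
have yx : y < x by rewrite gt_min; apply/orP; left; lra.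
have := Hr y; rewrite /= sub0r normrN gtr0_norm// gt_min.
have /= r0' := r0; rewrite (_ : r / 2 < r) ?orbT; last by lra.
by move=> /(_ isT); have := phi_lt _ _ y0 yx; rewrite ler_norml => H1 /andP[H2 H3]; lra.
Qed.

Lemma orlicz_le phi x y : orlicz_N_function phi -> 0 <= x -> x <= y ->
  phi x <= phi y.
Proof.
move=> Hphi x0 xy; have [cphi phiN _ phi_lt [phi0 _ _]] := Hphi.
have [<-//|xy'] := eqVneq x y.
have [->|x1] := eqVneq x 0; first by rewrite phi0 orlicz_ge0.
by rewrite ltW// phi_lt// lt_neqAle ?xy' ?xy// eq_sym x1 x0.
Qed.

Lemma orlicz_norm phi x : orlicz_N_function phi -> phi `|x| = phi x.
Proof. by move=> [_ phiN _ _ _]; case: ger0P => // _; rewrite phiN. Qed.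

Lemma orlicz_surj phi r : orlicz_N_function phi -> 0 <= r ->
  exists2 x, 0 <= x & phi x = r.
Proof.
move=> [cphi phiN _ phi_lt [phi0 _ phioo]] r0.
have [M M1 rM] : exists2 M, 1 <= M & r <= phi M.
  have := phioo; move=> /cvgryPge /(_ r) H.
  near +oo_R => M; exists M; first by near: M; exact: nbhs_pinfty_ge.
  have M1 : 1 <= M by near: M; exact: nbhs_pinfty_ge.
  have : r <= phi M / M by near: M; exact: H.
  rewrite ler_pdivlMr; last by apply: lt_le_trans M1.
  by apply: le_trans; rewrite ler_peMr.
have M0 : 0 <= M by apply: le_trans M1.
have [|c c0M <-] := @IVT R phi 0 M r M0 (continuous_subspaceT cphi).
  by rewrite phi0 min_l ?max_r ?r0//; exact: le_trans rM.
by exists c => //; rewrite (itvP c0M).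
Unshelve. all: by end_near. Qed.

Context {d : measure_display} {Omega : measurableType d}.
Variable P : probability Omega R.

Lemma mgf_le_tau phi (Y : Omega -> R) c l : orlicz_N_function phi ->
    (tau P phi Y <= c%:E)%E ->
  ('M_P Y l <= (expR (phi (c * l)))%:E)%E.
Proof.
move=> Hphi tauc.
have e1 : 1 <= expR (phi (c * l)) by rewrite -expR0 ler_expR orlicz_ge0.
have [->|l0] := eqVneq l 0.
  rewrite /mmt_gen_fun mulr0; have -> : expR \o 0 \o* Y = cst 1.
    by apply/funext => w /=; rewrite mulr0 expR0.
  have [_ _ _ _ [-> _ _]] := Hphi.
  rewrite expR0 unlock /= integral_cst// mul1e; exact: probability_le1.
have M0 : (0 <= 'M_P Y l)%E.
  by rewrite /mmt_gen_fun expectation_ge0// => w /=; exact: expR_ge0.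
have : (orlicz_inv phi (lne ('M_P Y l)) * (`|l|^-1)%:E <= c%:E)%E.
  by apply: le_trans tauc; apply: ereal_sup_ubound; exists l.
have nl0 : 0 < `|l|^-1 by rewrite invr_gt0 normr_gt0.
(* An infinite moment generating function would make the left side of the norm bound infinite. *)
move: ('M_P Y l)%E M0 => [m| |//]; last first.
  by rewrite /= => _; rewrite mulyr gtr0_sg// mul1e leye_eq.
rewrite lee_fin => m0 /=.
(* For m <= 1 the bound is immediate from phi >= 0; otherwise ln m is positive and lies in the range
   of phi on [0, +oo[. *)
have [m1|m1] := leP m 1; first by move=> _; rewrite lee_fin (le_trans m1).
rewrite (lt_geF (lt_trans ltr01 m1)) /=.
have [x x0 xm] := orlicz_surj Hphi (ltW (ln_gt0 m1)).
set y := pinv _ _ _.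
have im : ln m \in phi @` [set` `[0, +oo[].
  by rewrite inE; exists x => //=; rewrite in_itv /= x0.
have ym : phi y = ln m by rewrite /y pinvK.
rewrite -EFinM lee_fin ler_pdivrMr ?normr_gt0// => yc.
rewrite lee_fin -(lnK (_ : m \is Num.pos)) ?posrE ?(lt_trans ltr01)//.
rewrite ler_expR -ym -(orlicz_norm y Hphi) -(orlicz_norm (c * l) Hphi).
apply: orlicz_le => //.
have y0 : 0 <= y.
  have : [set` `[0, +oo[] y.
    apply: (surjpinv_image_sub (B := phi @` [set` `[0, +oo[]) (@subset_refl _ _)).
    by exists (ln m) => //; move: im; rewrite inE.
  by rewrite /= in_itv /= andbT.
rewrite (ger0_norm y0); apply: (le_trans yc).
by rewrite normrM ler_wpM2r// ler_norm.
Qed.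

End sub_gaussian_bound.

(** * Densities, the restricted supremum and the exponential inequality *)

Section density.
Context {R : realType}.
Implicit Types (phi f : R -> R).

Lemma density_ge0 phi f x : is_density phi f -> 0 <= x -> 0 <= f x.
Proof.
move=> [fhomo _ f0 _ _] x0; rewrite -[leLHS]f0.
by apply: fhomo => //; rewrite in_itv /= ?lexx ?x0.
Qed.

Lemma density_increment phi f a b : is_density phi f -> 0 <= a -> a <= b ->
  phi b - phi a <= f b * (b - a).
Proof.
move=> Hf a0 ab; have [fhomo _ f0 _ phiE] := Hf; have b0 := le_trans a0 ab.
(* Extending f by its value at 0 gives a monotone, hence measurable, function on the whole line. *)
pose g x := f (Num.max x 0).
have gmono : {homo g : x y / x <= y}.
  move=> x y xy; apply: fhomo; [by rewrite in_itv /= le_max lexx orbT..|].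
  by rewrite ge_max !le_max xy lexx orbT.
have mg D : measurable D -> measurable_fun D g.
  by move=> mD; exact: nondecreasing_measurable.
have gf x : 0 <= x -> g x = f x by move=> x0; rewrite /g max_l.
have phiG u : 0 <= u -> ((phi u)%:E =
    \int[lebesgue_measure]_(v in `[0%R, u]) (g v)%:E)%E.
  move=> u0; rewrite phiE ger0_norm//; apply: eq_integral => x.
  by rewrite inE /= in_itv /= => /andP[x0 _]; rewrite gf.
have g0 x : 0 <= g x.
  by apply: (density_ge0 Hf); rewrite le_max lexx orbT.
have split : `[0, b]%classic = `[0, a]%classic `|` `]a, b]%classic.
  apply/seteqP; split=> x /=; rewrite !in_itv /=.
    move=> /andP[-> xb]; rewrite xb andbT.
    by have [xa|xa] := leP x a; [left|right].
  move=> [/andP[-> xa]|/andP[ax ->]]; first exact: le_trans ab.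
  by rewrite (le_trans a0 (ltW ax)).
have : ((phi b)%:E <= (phi a)%:E + (f b * (b - a))%:E)%E.
  rewrite (phiG _ b0) (phiG _ a0) split ge0_integral_setU//=.
  - rewrite leeD2l//.
    apply: (@le_trans _ _ (\int[lebesgue_measure]_(v in `]a, b]) (cst (f b)%:E v))%E).
      apply: ge0_le_integral => //.
      + by move=> x _; rewrite lee_fin.
      + by apply/measurable_EFinP; exact: mg.
      + by move=> x; rewrite /= in_itv /= => /andP[_ xb]; rewrite lee_fin -gf// gmono.
    rewrite integral_cst//= lebesgue_measure_itv /= lte_fin.
    case: ltP => [_|ba]; first by rewrite -EFinB -EFinM.
    by rewrite mule0 lee_fin mulr_ge0 ?subr_ge0// -gf.
  - by apply/measurable_EFinP; apply: mg; exact: measurableU.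
  - by move=> x _; rewrite lee_fin.
  - apply/disj_setPS => x /= []; rewrite !in_itv /= => /andP[_ xa] /andP[ax _].
    by have := lt_le_trans ax xa; rewrite ltxx.
by rewrite -EFinD lee_fin; lra.
Qed.

(** On [0, a] the slopes of phi are at most f a <= u, so moving l up to a does not decrease u l -
    phi l. For l < 0 that value is at most 0, which a already attains or exceeds. *)
Lemma young_fenchel_restrict phi f u a l :
    orlicz_N_function phi -> is_density phi f ->
    0 <= a -> 0 <= u -> f a <= u ->
  exists2 l', a <= l' & u * l - phi l <= u * l' - phi l'.
Proof.
move=> Hphi Hf a0 u0 fau; have [al|la] := leP a l; first by exists l.
exists a => //; have [l0|l0] := leP 0 l.
  have := density_increment Hf l0 (ltW la).
  have : 0 <= (u - f a) * (a - l) by rewrite mulr_ge0// subr_ge0// ltW.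
  nra.
have := density_increment Hf (lexx 0) a0; have [_ _ _ _ [phi0 _ _]] := Hphi.
rewrite phi0 !subr0 => H.
have : 0 <= (u - f a) * a by rewrite mulr_ge0// subr_ge0.
have := orlicz_ge0 l Hphi.
have : u * l <= 0 by rewrite mulr_ge0_le0// ltW.
nra.
Qed.

(* Convexity of exp at the points [q ln y^p] and 0, with [ln y <= y - 1]. *)
Lemma powR_le_expR (p q l u v : R) : 0 < p -> 0 < u -> 0 <= v -> 1 <= q ->
  l * u = p * q -> q * (v / u) `^ p <= expR (l * (v - u)) + (q - 1).
Proof.
move=> p0 u0 v0 q1 lu; have [->|vn0] := eqVneq v 0.
  rewrite mul0r powR0 ?gt_eqF// mulr0 addr_ge0 ?expR_ge0// subr_ge0//.
have {v0 vn0} v0 : 0 < v by rewrite lt_neqAle eq_sym vn0.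
set y := v / u; have y0 : 0 < y by rewrite divr_gt0.
have -> : l * (v - u) = p * q * (y - 1) by rewrite -lu /y; field; rewrite gt_eqF.
have lny : ln y <= y - 1 by have := @le_ln1Dx R (y - 1); rewrite subrKC; apply; lra.
set w := p * ln y.
have pE : y `^ p = expR w by rewrite /powR gt_eqF.
have E1 : expR (q * w) <= expR (p * q * (y - 1)).
  by rewrite ler_expR /w mulrCA mulrA ler_wpM2l// mulr_ge0 ?(ltW p0)//; lra.
have E2 : expR w * (1 + (q - 1) * w) <= expR (q * w).
  have -> : q * w = w + (q - 1) * w by ring.
  by rewrite expRD ler_wpM2l ?expR_ge0// expR_ge1Dx.
have E3 : expR w * (1 - w) <= 1.
  by rewrite -[leRHS](expRxMexpNx_1 w) ler_wpM2l ?expR_ge0// expR_ge1Dx.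
have E4 : (q - 1) * (expR w * (1 - w)) <= (q - 1) * 1 by rewrite ler_wpM2l// subr_ge0.
(* Adding [E2] and [E4] cancels the terms in w exp(w). *)
rewrite pE; nra.
Qed.

End density.

(** * Tails of path integrals *)

Section tail.
Context {d : measure_display} {Omega : measurableType d} {R : realType}.
Variable P : probability Omega R.

(** exp|s| <= exp(s) + exp(-s), the source of the factor 2 in the tail bound. *)
Lemma expR_abs_le (Y : Omega -> R) a K : measurable_fun [set: Omega] Y ->
    ('M_P Y a <= K%:E)%E -> ('M_P Y (- a) <= K%:E)%E ->
  (\int[P]_w (expR (a * `|Y w|))%:E <= (2 * K)%:E)%E.
Proof.
move=> mY Ka KNa.
have mexp b : measurable_fun [set: Omega] (fun w => expR (b * Y w)).
  by apply: measurableT_comp => //; exact: measurable_funM.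
have ME b : 'M_P Y b = (\int[P]_w (expR (b * Y w))%:E)%E.
  rewrite /mmt_gen_fun unlock; apply: eq_integral => w _ /=.
  by rewrite mulrC.
apply: (@le_trans _ _ (\int[P]_w ((expR (a * Y w))%:E + (expR (- a * Y w))%:E))%E).
  apply: ge0_le_integral => //.
  - by apply/measurable_EFinP; apply: measurableT_comp => //; apply: measurable_funM => //; exact: measurableT_comp.
  - by apply: emeasurable_funD; apply/measurable_EFinP.
  - move=> w _; rewrite -EFinD lee_fin.
    case: ger0P => _; first by rewrite lerDl expR_ge0.
    by rewrite mulrN -mulNr lerDr expR_ge0.
rewrite ge0_integralD//; [|exact/measurable_EFinP|exact/measurable_EFinP].
by rewrite -!ME mulr_natl mulr2n EFinD leeD.
Qed.

Variables (T : R) (Y : R -> Omega -> R).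
Hypothesis mY : measurable_fun [set: R * Omega] (fun x => Y x.1 x.2).

Local Notation mu := (@lebesgue_measure R).

Lemma measurable_sections t : measurable_fun [set: Omega] (Y t).
Proof. exact: (measurable_fun_pair2 t mY). Qed.

Lemma measurable_paths w : measurable_fun [set: R] (Y^~ w).
Proof. exact: (measurable_fun_pair1 w mY). Qed.

Lemma restrict_indic (D : set R) (h : R -> R) :
  (EFin \o h) \_ D = (fun t => (h t * \1_D t)%:E).
Proof.
apply/funext => t; rewrite patchE indicE.
by case: ifPn => tD; rewrite /= ?mulr1 ?mulr0.
Qed.

Lemma measurable_path_integral (D : set R) (G : R * Omega -> R) :
    measurable D -> measurable_fun [set: R * Omega] G -> (forall x, 0 <= G x) ->
  measurable_fun [set: Omega] (fun w => \int[mu]_(t in D) (G (t, w))%:E)%E.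
Proof.
move=> mD mG G0.
have -> : (fun w => \int[mu]_(t in D) (G (t, w))%:E)%E =
    fubini_G mu (fun x => (G x * \1_D x.1)%:E).
  apply/funext => w; rewrite integral_mkcond.
  by rewrite (restrict_indic D (fun t => G (t, w))).
apply: measurable_fun_fubini_tonelli_G.
  apply/measurable_EFinP; apply: measurable_funM => //.
  exact: measurableT_comp.
by move=> x; rewrite lee_fin mulr_ge0.
Qed.

Lemma tonelli_restrict (D : set R) (G : R * Omega -> R) :
    measurable D -> measurable_fun [set: R * Omega] G -> (forall x, 0 <= G x) ->
  (\int[P]_w \int[mu]_(t in D) (G (t, w))%:E =
   \int[mu]_(t in D) \int[P]_w (G (t, w))%:E)%E.
Proof.
move=> mD mG G0; pose F x := (G x * \1_D x.1)%:E.
have mF : measurable_fun [set: R * Omega] F.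
  by apply/measurable_EFinP; apply: measurable_funM => //; exact: measurableT_comp.
have F0 x : (0 <= F x)%E by rewrite lee_fin mulr_ge0.
transitivity (\int[P]_w \int[mu]_t F (t, w))%E.
  apply: eq_integral => w _; rewrite integral_mkcond.
  by rewrite (restrict_indic D (fun t => G (t, w))).
transitivity (\int[mu]_t \int[P]_w F (t, w))%E.
  by apply/esym; refine (@fubini_tonelli _ _ (measurableTypeR R) Omega R mu P F mF F0).
rewrite [RHS]integral_mkcond.
apply: eq_integral => t _; rewrite patchE /F; case: ifPn => tD /=.
  by apply: eq_integral => w _; rewrite indicE tD mulr1.
by apply: integral0_eq => w _; rewrite indicE (negbTE tD) mulr0.
Qed.

Lemma measurable_norm_powR p :
  measurable_fun [set: R * Omega] (fun x => `|Y x.1 x.2| `^ p).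
Proof.
by apply: (measurableT_comp (@measurable_powR R p)); exact: measurableT_comp.
Qed.

Lemma measurable_Lp_integral p (D : set R) : measurable D ->
  measurable_fun [set: Omega] (fun w => \int[mu]_(t in D) (`|Y t w| `^ p)%:E)%E.
Proof.
move=> mD; exact: (measurable_path_integral mD (measurable_norm_powR p)
  (fun x => powR_ge0 _ _)).
Qed.

Variables (c : R -> R) (phi : R -> R) (p S : R).
Local Notation D := (`[0%R, T]%classic : set R).
Hypotheses (p1 : 1 <= p) (S0 : 0 < S) (phiN : forall x, phi (- x) = phi x).
Hypotheses (mc : measurable_fun [set: R] c) (c0 : forall t, D t -> 0 < c t).
Hypothesis cS : (\int[mu]_(t in D) (c t `^ p)%:E = S%:E)%E.
Hypothesis mgf : forall t l, D t -> ('M_P (Y t) l <= (expR (phi (c t * l)))%:E)%E.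

Let p0 : 0 < p. Proof. exact: lt_le_trans p1. Qed.

(* On [0, T], where [0 < c t], the factor [c t `^ (- 1)] is [(c t)^-1]. *)
Definition exp_weight l u (x : R * Omega) : R :=
  c x.1 `^ p / S * expR (l * (`|Y x.1 x.2| * c x.1 `^ (- 1) - u)).

Lemma exp_weight_ge0 l u x : 0 <= exp_weight l u x.
Proof. by rewrite mulr_ge0 ?expR_ge0// divr_ge0 ?powR_ge0// ltW. Qed.

Lemma measurable_exp_weight l u : measurable_fun [set: R * Omega] (exp_weight l u).
Proof.
have mc1 q : measurable_fun [set: R * Omega] (fun x => c x.1 `^ q).
  apply: (measurableT_comp (@measurable_powR R q)).
  exact: measurableT_comp.
apply: measurable_funM; first exact: measurable_funM.
apply: measurableT_comp => //; apply: measurable_funM => //.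
apply: measurable_funB => //; apply: measurable_funM => //.
exact: measurableT_comp.
Qed.

(** After Tonelli, the bound on the inner expectation depends on t only through c(t)^p / S, which
    integrates to 1. *)
Lemma expected_weight_le l u :
  (\int[P]_w \int[mu]_(t in D) (exp_weight l u (t, w))%:E <=
   (2 * expR (phi l - u * l))%:E)%E.
Proof.
rewrite (tonelli_restrict (measurable_itv _) (measurable_exp_weight l u) (exp_weight_ge0 l u)).
have mcp : measurable_fun D (fun t => (c t `^ p)%:E).
  apply/measurable_EFinP; apply: measurable_funTS.
  exact: (measurableT_comp (@measurable_powR R p)).
apply: (@le_trans _ _ (\int[mu]_(t in D)
    ((2 * expR (phi l - u * l) / S)%:E * (c t `^ p)%:E))%E).
  apply: ge0_le_integral => //.
  - by move=> t _; apply: integral_ge0 => w _; rewrite lee_fin exp_weight_ge0.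
  - apply: measurable_funTS.
    have : measurable_fun [set: R] (fubini_F P (fun x => (exp_weight l u x)%:E)).
      apply: measurable_fun_fubini_tonelli_F; first last.
        by move=> x; rewrite lee_fin exp_weight_ge0.
      by apply/measurable_EFinP; exact: (measurable_exp_weight l u).
    by [].
  - by apply: emeasurable_funM.
  - move=> t Dt; have ct := c0 Dt.
    have -> : (\int[P]_w (exp_weight l u (t, w))%:E =
        \int[P]_w ((c t `^ p / S * expR (- (l * u)))%:E *
                   (expR (l / c t * `|Y t w|))%:E))%E.
      apply: eq_integral => w _; rewrite -EFinM /exp_weight /= powR_inv1 ?(ltW ct)//.
      congr EFin; rewrite -[RHS]mulrA -expRD; congr (_ * expR _).
      by field; rewrite gt_eqF.
    have k0 : 0 <= c t `^ p / S * expR (- (l * u)).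
      by rewrite mulr_ge0 ?expR_ge0// divr_ge0 ?powR_ge0// ltW.
    rewrite ge0_integralZl//; first last.
    + apply/measurable_EFinP; apply: measurableT_comp => //.
      apply: measurable_funM => //; apply: measurableT_comp => //.
      exact: measurable_sections.
    (* Evaluating the moment generating function at l / c(t) makes its bound exp(phi(l)), the same
       for all t. *)
    have cl : c t * (l / c t) = l by rewrite mulrC divfK// gt_eqF.
    have H1 := mgf (l / c t) Dt; have H2 := mgf (- (l / c t)) Dt.
    rewrite mulrN cl phiN in H2; rewrite cl in H1.
    have := expR_abs_le (measurable_sections t) H1 H2.
    move=> /(@lee_wpmul2l _ (c t `^ p / S * expR (- (l * u)))%:E).
    rewrite lee_fin => /(_ k0) /le_trans; apply.
    rewrite -!EFinM lee_fin expRD (mulrC l u).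
    by rewrite le_eqVlt; apply/orP; left; apply/eqP; ring.
rewrite ge0_integralZl//.
- by rewrite cS -EFinM divfK// gt_eqF.
- by move=> t _; rewrite lee_fin powR_ge0.
- by rewrite lee_fin divr_ge0 ?mulr_ge0 ?expR_ge0// ltW.
Qed.

(** Integrating [powR_le_expR] against c^p / S with v = |Y| / c, the left side exceeds q on the
    event, while the right side is the integrated weight plus q - 1. *)
Lemma weight_ge1 l u w : 0 < u -> p <= l * u ->
    ((S * u `^ p)%:E < \int[mu]_(t in D) (`|Y t w| `^ p)%:E)%E ->
  (1 <= \int[mu]_(t in D) (exp_weight l u (t, w))%:E)%E.
Proof.
move=> u0 plu Zgt; pose q := l * u / p.
have q1 : 1 <= q by rewrite ler_pdivlMr// mul1r.
have q0 : 0 < q by apply: lt_le_trans q1.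
have mD : measurable D by exact: measurable_itv.
have up0 : 0 < S * u `^ p by rewrite mulr_gt0// powR_gt0.
have mYp : measurable_fun D (fun t => (`|Y t w| `^ p)%:E).
  apply/measurable_EFinP; apply: measurable_funTS.
  apply: (measurableT_comp (@measurable_powR R p)).
  by apply: measurableT_comp => //; exact: measurable_paths.
have mcp : measurable_fun D (fun t => (c t `^ p)%:E).
  apply/measurable_EFinP; apply: measurable_funTS.
  exact: (measurableT_comp (@measurable_powR R p)).
have mWw : measurable_fun D (fun t => (exp_weight l u (t, w))%:E).
  by apply/measurable_EFinP; apply: measurable_funTS; exact: (measurable_fun_pair1 w (measurable_exp_weight l u)).
have S10 : 0 <= (q - 1) / S by rewrite divr_ge0 ?subr_ge0// ltW.
have qS0 : 0 <= q / (S * u `^ p) by rewrite divr_ge0// ltW.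
have : (\int[mu]_(t in D) ((q / (S * u `^ p))%:E * (`|Y t w| `^ p)%:E) <=
    \int[mu]_(t in D) ((exp_weight l u (t, w))%:E + ((q - 1) / S)%:E * (c t `^ p)%:E))%E.
  apply: ge0_le_integral => //.
  - by move=> t _; rewrite -EFinM lee_fin mulr_ge0 ?powR_ge0.
  - exact: emeasurable_funM.
  - by apply: emeasurable_funD => //; exact: emeasurable_funM.
  - move=> t Dt; have ct := c0 Dt; have v0 : 0 <= `|Y t w| / c t by rewrite divr_ge0// ltW.
    have luq : l * u = p * q by rewrite /q [RHS]mulrC divfK// gt_eqF.
    have := powR_le_expR p0 u0 v0 q1 luq.
    have K0 : 0 <= c t `^ p / S by rewrite divr_ge0 ?powR_ge0// ltW.
    move=> /(ler_wpM2l K0) H.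
    rewrite -!EFinM -EFinD lee_fin /exp_weight /= powR_inv1 ?(ltW ct)//.
    apply: le_trans (le_trans H _).
      have -> : `|Y t w| `^ p = (`|Y t w| / c t / u) `^ p * (c t `^ p * u `^ p).
        have c1 := ltW ct; have u1 := ltW u0.
        rewrite -(powRM _ c1 u1) -(powRM _ (divr_ge0 v0 u1) (mulr_ge0 c1 u1)).
        by congr (_ `^ _); field; rewrite !gt_eqF.
      rewrite le_eqVlt; apply/orP; left; apply/eqP; field.
      by rewrite !gt_eqF// powR_gt0.
    by rewrite mulrDr lerD2l le_eqVlt; apply/orP; left; apply/eqP; ring.
rewrite ge0_integralZl//.
rewrite ge0_integralD//; last 3 first.
- by move=> t _; rewrite lee_fin exp_weight_ge0.
- by move=> t _; rewrite -EFinM lee_fin mulr_ge0 ?powR_ge0.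
- exact: emeasurable_funM.
rewrite ge0_integralZl//; last by move=> t _; rewrite lee_fin powR_ge0.
rewrite cS -EFinM divfK ?gt_eqF// => H.
have : (q%:E <= \int[mu]_(t in D) (exp_weight l u (t, w))%:E + (q - 1)%:E)%E.
  apply: le_trans H.
  have -> : q%:E = ((q / (S * u `^ p))%:E * (S * u `^ p)%:E)%E.
    by rewrite -EFinM divfK// gt_eqF.
  by rewrite lee_wpmul2l// ltW.
by rewrite -leeBlDr// -EFinB opprB addrCA subrr addr0.
Qed.

Lemma tail_le l u : 0 < u -> p <= l * u ->
  (P [set w | ((S * u `^ p)%:E < \int[mu]_(t in D) (`|Y t w| `^ p)%:E)%E] <=
   (2 * expR (- (u * l - phi l)))%:E)%E.
Proof.
move=> u0 plu; set A := [set w | _].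
have mA : measurable A.
  have mZ := measurable_Lp_integral p (measurable_itv `[0, T]).
  by rewrite -[A]setTI; exact: emeasurable_fun_o_infty.
rewrite opprB; apply: le_trans (expected_weight_le l u).
have -> : P A = (\int[P]_w (\1_A w)%:E)%E by rewrite integral_indic// setIT.
apply: ge0_le_integral => //.
- exact/measurable_EFinP/measurable_indic.
- exact: (measurable_path_integral (measurable_itv _) (measurable_exp_weight l u)
    (exp_weight_ge0 l u)).
- move=> w _; rewrite indicE; case: (boolP (w \in A)) => [|_].
    by rewrite inE => Aw; apply: weight_ge1.
  by apply: integral_ge0 => t _; rewrite lee_fin exp_weight_ge0.
Qed.

(** With u = 1, l = p and q = 1, [powR_le_expR] gives |Y|^p <= S times the weight; the integrated
    weight has finite expectation, so the path integral is finite almost surely. *)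
Lemma ae_integrable_paths :
  {ae P, forall w, mu.-integrable D (fun t => (`|Y t w| `^ p)%:E)}.
Proof.
have mD : measurable (`[0%R, T]%classic : set R) by exact: measurable_itv.
have mYp := measurable_norm_powR p; have mZ := measurable_Lp_integral p mD.
have mWZ := measurable_path_integral mD (measurable_exp_weight p 1)
  (exp_weight_ge0 p 1).
have YW t w : D t -> `|Y t w| `^ p <= S * exp_weight p 1 (t, w).
  move=> Dt; have ct := c0 Dt.
  have v0 : 0 <= `|Y t w| / c t by rewrite divr_ge0// ltW.
  have := powR_le_expR p0 ltr01 v0 (lexx 1) (erefl (p * 1)).
  rewrite mul1r divr1 subrr addr0 => H.
  rewrite /exp_weight /= powR_inv1 ?(ltW ct)// mulrA (mulrC S) divfK ?gt_eqF//.
  apply: le_trans (ler_wpM2l (powR_ge0 _ _) H).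
  by rewrite -powRM ?(ltW ct)// mulrC divfK// gt_eqF.
have Z0 w : (0 <= \int[mu]_(t in D) (`|Y t w| `^ p)%:E)%E.
  by apply: integral_ge0 => t _; rewrite lee_fin powR_ge0.
have iZ : P.-integrable [set: Omega]
    (fun w => \int[mu]_(t in D) (`|Y t w| `^ p)%:E)%E.
  apply/integrableP; split => //.
  under eq_integral do rewrite gee0_abs//.
  apply: (@le_lt_trans _ _ (\int[P]_w
      (S%:E * \int[mu]_(t in D) (exp_weight p 1 (t, w))%:E))%E).
    apply: ge0_le_integral => //; first exact: emeasurable_funM.
    move=> w _; rewrite -ge0_integralZl//.
    - apply: ge0_le_integral => //.
      + by apply/measurable_EFinP; apply: measurable_funTS; exact: (measurable_fun_pair1 w mYp).
      + apply: emeasurable_funM => //; apply/measurable_EFinP; apply: measurable_funTS.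
        exact: (measurable_fun_pair1 w (measurable_exp_weight p 1)).
      + by move=> t Dt; rewrite -EFinM lee_fin YW.
    - apply/measurable_EFinP; apply: measurable_funTS.
      exact: (measurable_fun_pair1 w (measurable_exp_weight p 1)).
    - by move=> t _; rewrite lee_fin exp_weight_ge0.
    - by rewrite lee_fin ltW.
  rewrite ge0_integralZl//.
  - apply: lte_mul_pinfty; rewrite ?lee_fin ?(ltW S0)//.
    by apply: le_lt_trans (expected_weight_le p 1) _; rewrite ltry.
  - by move=> w _; apply: integral_ge0 => t _; rewrite lee_fin exp_weight_ge0.
  - by rewrite lee_fin ltW.
apply: filterS (integrable_ae measurableT iZ) => w /(_ I) Zw.
apply/integrableP; split.
  by apply/measurable_EFinP; apply: measurable_funTS; exact: (measurable_fun_pair1 w mYp).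
under eq_integral do rewrite gee0_abs ?lee_fin ?powR_ge0//.
by rewrite ltey_eq Zw.
Qed.

End tail.

(** * The sampling error *)

Section sampling_moments.
Context {R : realType}.
Implicit Types (B : R -> R) (omega Lambda z T t x : R).

Lemma C_bound_gt0 B omega Lambda z n t : 0 < Lambda -> Lambda < omega ->
  0 < z -> z < 1 -> (0 < n)%N -> 0 < B 0 -> 0 <= t ->
  0 < C_bound B omega Lambda z n t.
Proof.
move=> L0 Lo z0 z1 n0 B0 t0; have pi0 := pi_gt0 R.
have n0R : 0 < n%:R :> R by rewrite ltr0n.
have o0 := lt_trans L0 Lo; have rho1 : Lambda / omega < 1 by rewrite ltr_pdivrMr ?mul1r.
rewrite /C_bound mulr_gt0// exprn_gt0// ltr_wpDl//.
  by rewrite divr_ge0 ?mulr_ge0 ?exprn_ge0 ?subr_ge0// ltW.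
rewrite divr_gt0 ?mulr_gt0 ?exprn_gt0 ?subr_gt0//.
by rewrite addr_gt0 ?invr_gt0// addr_gt0.
Qed.

Lemma C_bound_le B omega Lambda z n t x : 0 < Lambda -> Lambda < omega ->
  0 < z -> z < 1 -> (0 < n)%N -> 0 <= B 0 -> 0 <= t -> t <= x ->
  C_bound B omega Lambda z n t <= C_bound B omega Lambda z n x.
Proof.
move=> L0 Lo z0 z1 n0 B0 t0 tx; have pi0 := pi_gt0 R.
have n0R : 0 < n%:R :> R by rewrite ltr0n.
have o0 := lt_trans L0 Lo; have rho1 : Lambda / omega < 1 by rewrite ltr_pdivrMr ?mul1r.
have k0 : 0 <= 4 * (z + 1 + n%:R^-1) / (pi * (1 - z) ^+ 2 * (1 - Lambda / omega)).
  rewrite divr_ge0 ?mulr_ge0 ?exprn_ge0 ?subr_ge0 ?(ltW rho1) ?(ltW pi0) ?(ltW z1)//.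
  by rewrite addr_ge0 ?invr_ge0// addr_ge0// ltW.
have d0 : 0 <= (pi ^+ 2 * (1 - z))^-1.
  by rewrite invr_ge0 mulr_ge0 ?exprn_ge0 ?subr_ge0// ltW.
have x0 := le_trans t0 tx.
have A0 y : 0 <= y -> 0 <= 4 * omega * y / (pi ^+ 2 * (1 - z)).
  by move=> y0; rewrite mulr_ge0 ?mulr_ge0// ltW.
rewrite /C_bound ler_wpM2l// ler_pXn2r ?nnegrE ?(addr_ge0 (A0 _ _))//.
by rewrite lerD2r ler_wpM2r// ler_wpM2l// mulr_ge0// ltW.
Qed.

Lemma measurable_C_bound B omega Lambda z n :
  measurable_fun [set: R] (C_bound B omega Lambda z n).
Proof.
apply: measurable_funM => //; apply: measurable_funX.
by apply: measurable_funD => //; apply: measurable_funM => //; apply: measurable_funM.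
Qed.

(** [wave_error] at x = omega t / pi and theta = pi x / omega, with rho = Lambda / omega; the size
    condition on n is what gives (omega t / pi)^2 <= z n^2. *)
Lemma wave_error_C_bound B omega Lambda z T (n : nat) t x :
    0 < Lambda -> Lambda < omega -> 0 < z -> z < 1 -> (0 < n)%N ->
    omega * T / (pi * Num.sqrt z) <= n%:R -> 0 <= t <= T -> 0 <= B 0 ->
    `|x| <= Lambda ->
  ((1 - wave (omega * t / pi) 0 n (pi * x / omega)) ^+ 2 +
   wave (omega * t / pi) (- (pi / 2)) n (pi * x / omega) ^+ 2) * B 0 <=
  C_bound B omega Lambda z n t / n%:R ^+ 2.
Proof.
move=> L0 Lo z0 z1 n0 nlarge /andP[t0 tT] B0 xL; have pi0 := pi_gt0 R.
have n0R : 0 < n%:R :> R by rewrite ltr0n.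
have o0 := lt_trans L0 Lo; have rho1 : Lambda / omega < 1 by rewrite ltr_pdivrMr ?mul1r.
have sz0 : 0 < Num.sqrt z by rewrite sqrtr_gt0.
have xi0 : 0 <= omega * t / pi by rewrite divr_ge0 ?mulr_ge0// ltW.
have xin : omega * t / pi <= Num.sqrt z * n%:R.
  rewrite ler_pdivrMr//; rewrite ler_pdivrMr ?mulr_gt0// in nlarge.
  apply: le_trans (_ : omega * T <= _); first by rewrite ler_wpM2l// ltW.
  by apply: (le_trans nlarge); rewrite le_eqVlt; apply/orP; left; apply/eqP; ring.
have xi2 : (omega * t / pi) ^+ 2 <= z * n%:R ^+ 2.
  rewrite -[z in leRHS]sqr_sqrtr ?(ltW z0)// -exprMn.
  by rewrite ler_pXn2r ?nnegrE// mulr_ge0// ltW.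
have th : `|pi * x / omega| <= pi * (Lambda / omega).
  rewrite !normrM normfV (gtr0_norm pi0) (gtr0_norm o0) -mulrA.
  by rewrite ler_wpM2l ?(ltW pi0)// ler_wpM2r// invr_ge0 ltW.
have := wave_error xi0 z1 xi2 n0 rho1 th.
move=> /(ler_wpM2r B0) /le_trans; apply.
rewrite /C_bound [leLHS]mulrC -[leRHS]mulrA ler_wpM2l//.
rewrite -expr_div_n ler_pXn2r ?nnegrE//.
- rewrite ler_wpM2r ?invr_ge0 ?(ltW n0R)// lerD//.
    have -> : 2 * (omega * t / pi) / (pi * (1 - z)) =
        2 * omega * t / (pi ^+ 2 * (1 - z)).
      move: (pi : R) pi0 => p p0; field.
      by rewrite !gt_eqF ?subr_gt0.
    have d0 : 0 <= (pi ^+ 2 * (1 - z))^-1.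
      by rewrite invr_ge0 mulr_ge0 ?exprn_ge0 ?subr_ge0// ltW.
    have ot0 : 0 <= omega * t by rewrite mulr_ge0// ltW.
    by rewrite ler_wpM2r// -!mulrA ler_wpM2r// ler_nat.
  (* Over the common denominator the comparison of numerators is 1 - z <= z + 1 + 1/n. *)
  have -> : 4 / (pi * (1 - z) * (1 - Lambda / omega)) =
      4 * (1 - z) / (pi * (1 - z) ^+ 2 * (1 - Lambda / omega)).
    move: (pi : R) pi0 => p p0; have : 1 - Lambda / omega != 0.
      by rewrite gt_eqF ?subr_gt0.
    move: (1 - Lambda / omega) => r r0; field.
    by rewrite r0 !gt_eqF ?subr_gt0.
  rewrite ler_wpM2r ?invr_ge0 ?mulr_ge0 ?exprn_ge0 ?subr_ge0 ?(ltW rho1) ?(ltW pi0) ?(ltW z1)//.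
  rewrite ler_wpM2l//.
  have : 0 <= n%:R^-1 :> R by rewrite invr_ge0.
  lra.
- have pz0 : 0 <= pi * (1 - z) by rewrite mulr_ge0 ?subr_ge0// ltW.
  have pzr0 : 0 <= pi * (1 - z) * (1 - Lambda / omega).
    by rewrite mulr_ge0 ?subr_ge0// ltW.
  by rewrite divr_ge0// addr_ge0// divr_ge0//; exact: mulr_ge0.
- rewrite divr_ge0// addr_ge0//.
    by rewrite divr_ge0 ?mulr_ge0 ?exprn_ge0 ?subr_ge0 ?(ltW z1) ?(ltW pi0)// ltW.
  rewrite divr_ge0 ?mulr_ge0 ?exprn_ge0 ?subr_ge0 ?(ltW rho1) ?(ltW pi0) ?(ltW z1)//.
  by rewrite addr_ge0 ?invr_ge0// addr_ge0// ltW.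
Qed.

Lemma measurable_sinc : measurable_fun [set: R] (@sinc R).
Proof.
(* By evenness sinc is a product of measurable functions of |x|; that product is 0 at 0, where the
   indicator restores the value 1. *)
have -> : @sinc R = (fun x => sin `|x| * `|x| `^ (- 1) + \1_[set 0] x).
  apply/funext => x; rewrite indicE /sinc.
  have [->|x0] := eqVneq x 0.
    by rewrite normr0 sin0 mul0r add0r mem_set.
  rewrite memNset; last by apply/eqP.
  rewrite addr0 powR_inv1//; case: ger0P => // _.
  by rewrite sinN invrN mulrNN.
have msin : measurable_fun [set: R] (@sin R).
  by apply: continuous_measurable_fun; exact: continuous_sin.
apply: measurable_funD; last exact: measurable_indic.
apply: measurable_funM; first exact: measurableT_comp.
exact: (measurableT_comp (@measurable_powR R (- 1))).
Qed.

Context {d : measure_display} {Omega : measurableType d}.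
Variable P : probability Omega R.
Implicit Types (X : R -> Omega -> R) (phi : R -> R).

(** With [coef], this writes X(t) - X_n(t) as one linear combination, as the [SSub] bound requires:
    index 0 stands for t with coefficient 1, the others for the sampling points. *)
Let node omega (n : nat) t (i : 'I_(n.*2.+1).+1) : R :=
  if unlift ord0 i is Some j then (j%:R - n%:R) * pi / omega else t.

Let coef omega (n : nat) t (i : 'I_(n.*2.+1).+1) : R :=
  if unlift ord0 i is Some j
  then - sinc (omega * (t - (j%:R - n%:R) * pi / omega)) else 1.

Let sum_coef omega n t (g : R -> R) :
  \sum_i coef omega t i * g (@node omega n t i) = g t -
  \sum_(j < n.*2.+1) sinc (omega * (t - (j%:R - n%:R) * pi / omega)) *
    g ((j%:R - n%:R) * pi / omega).
Proof.
rewrite big_ord_recl /coef /node unlift_none mul1r -sumrN.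
congr (_ + _); apply: eq_bigr => j _.
by rewrite liftK mulNr.
Qed.

(** The change of variables from time and frequency to the unit-spaced nodes of [wave]. *)
Let sum_coef_wave omega n t b x : omega != 0 ->
  \sum_(j < n.*2.+1) sinc (omega * (t - (j%:R - n%:R) * pi / omega)) *
    cos (((j%:R - n%:R) * pi / omega - t) * x + b) =
  wave (omega * t / pi) b n (pi * x / omega).
Proof.
move=> o0; rewrite /wave -symsumE; apply: eq_bigr => j _.
have := pi_gt0 R; move=> /lt0r_neq0; move: (pi : R) => p p0.
by congr (sinc _ * cos (_ + _)); field; rewrite p0 o0.
Qed.

Lemma sampling_tau_le phi X B CX omega Lambda z T (n : nat) t :
    0 < Lambda -> Lambda < omega -> 0 < z -> z < 1 -> (0 < n)%N ->
    omega * T / (pi * Num.sqrt z) <= n%:R -> 0 <= t <= T ->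
    0 <= B 0 -> stationary P X B -> SSub P phi X CX -> bandlimited B Lambda ->
  (tau P phi (fun w => (X t w - sampling_sum X omega n t w)%R) <=
   (CX / n%:R * Num.sqrt (C_bound B omega Lambda z n t))%:E)%E.
Proof.
move=> L0 Lo z0 z1 n0 nlarge tT B0 Xst [CX0 XSub Xtau] Bband.
have n0R : 0 < n%:R :> R by rewrite ltr0n.
have o0 := lt_trans L0 Lo; have on0 : omega != 0 by rewrite gt_eqF.
have mX s : measurable_fun [set: Omega] (X s) by have [] := XSub s.
have YE w : X t w - sampling_sum X omega n t w =
    \sum_i coef omega t i * X (@node omega n t i) w.
  by rewrite (sum_coef omega n t (X^~ w)).
(* [C_bound] with unit variance is the deterministic error factor; [B 0] enters as the total
   spectral mass. *)
have E2 : ('E_P[(fun w => (\sum_i coef omega t i * X (@node omega n t i) w) ^+ 2)%R] <=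
    (C_bound (fun=> 1%R) omega Lambda z n t / n%:R ^+ 2 * B 0)%:E)%E.
  apply: (second_moment_le (s := t) Xst mX Bband) => x xL.
  (* Phases are measured from time t, so the point t contributes 1 to the cosine sum and 0 to the
     sine sum. *)
  have -> : \sum_i coef omega t i * cos ((@node omega n t i - t) * x) =
      1 - wave (omega * t / pi) 0 n (pi * x / omega).
    rewrite (sum_coef omega n t (fun s => cos ((s - t) * x))) subrr mul0r cos0.
    rewrite -sum_coef_wave//; congr (_ - _); apply: eq_bigr => j _.
    by rewrite addr0.
  have -> : \sum_i coef omega t i * sin ((@node omega n t i - t) * x) =
      - wave (omega * t / pi) (- (pi / 2)) n (pi * x / omega).
    rewrite (sum_coef omega n t (fun s => sin ((s - t) * x))) subrr mul0r sin0.
    rewrite -sum_coef_wave// sub0r; congr (- _); apply: eq_bigr => j _.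
    by rewrite cosBpihalf.
  rewrite sqrrN -[leLHS]mulr1.
  exact: (wave_error_C_bound (B := fun=> 1) L0 Lo z0 z1 n0 nlarge tT ler01 xL).
have CE : C_bound (fun=> 1) omega Lambda z n t / n%:R ^+ 2 * B 0 =
    C_bound B omega Lambda z n t / n%:R ^+ 2.
  by rewrite /C_bound mul1r mulrC mulrA.
rewrite CE in E2.
have E0 : (0 <= 'E_P[(fun w => (\sum_i coef omega t i * X (@node omega n t i) w) ^+ 2)%R])%E.
  by apply: expectation_ge0 => w; exact: sqr_ge0.
have := Xtau _ (@node omega n t) (coef omega t) => /=.
have -> : (fun w => (X t w - sampling_sum X omega n t w)%R) =
    (fun w => \sum_i coef omega t i * X (@node omega n t i) w).
  by apply/funext => w; exact: YE.
move=> /le_trans; apply.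
move: ('E_P[_])%E E0 E2 => [e| |//]; last by rewrite leye_eq.
rewrite poweR_EFin -EFinM !lee_fin => e0 eC; rewrite powR12_sqrt//.
rewrite -mulrA ler_wpM2l ?(ltW CX0)//.
have -> : n%:R^-1 * Num.sqrt (C_bound B omega Lambda z n t) =
    Num.sqrt (C_bound B omega Lambda z n t / n%:R ^+ 2).
  have Cb0 : 0 <= C_bound B omega Lambda z n t.
    by rewrite /C_bound mulr_ge0// sqr_ge0.
  rewrite [LHS]mulrC (sqrtrM _ Cb0).
  by rewrite -exprVn sqrtr_sqr ger0_norm// invr_ge0 ltW.
by rewrite ler_wsqrtr.
Qed.

End sampling_moments.

(** * Assembly of the tail bound *)

Section main.
Context {d : measure_display} {Omega : measurableType d} {R : realType}.
Variable P : probability Omega R.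
Implicit Types (B phi f : R -> R) (X : R -> Omega -> R).

Lemma stationary_var_ge0 X B : stationary P X B -> 0 <= B 0.
Proof.
move=> [_ XB]; rewrite -lee_fin -(XB 0 0) addr0.
by apply: expectation_ge0 => w; rewrite -expr2 sqr_ge0.
Qed.

Lemma measurable_sampling_error X omega n : measurable_process X ->
  measurable_fun [set: R * Omega]
    (fun x => X x.1 x.2 - sampling_sum X omega n x.1 x.2).
Proof.
move=> mX; apply: measurable_funB => //; apply: measurable_sum => j.
apply: measurable_funM.
  apply: (measurableT_comp measurable_sinc); apply: measurable_funM => //.
  exact: measurable_funB.
set tk := _ * pi / omega.
exact: (measurableT_comp (measurable_sections mX tk) measurable_snd).
Qed.

(** [S_bound] is a real-valued integral, so finiteness must be shown: the range is empty for T < 0,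
    and otherwise the increasing integrand is bounded by its value at T. *)
Lemma S_boundE B CX omega Lambda z T p n : 0 < Lambda -> Lambda < omega ->
    0 < z -> z < 1 -> (0 < n)%N -> 1 <= p -> 0 <= B 0 -> 0 <= CX ->
  (\int[lebesgue_measure]_(t in `[0%R, T])
    ((CX / n%:R * Num.sqrt (C_bound B omega Lambda z n t)) `^ p)%:E =
   (S_bound B CX omega Lambda z T p n)%:E)%E.
Proof.
move=> L0 Lo z0 z1 n0 p1 B0 CX0.
have p0 : 0 < p by apply: lt_le_trans p1.
have Cb0 t : 0 <= C_bound B omega Lambda z n t by rewrite mulr_ge0 ?sqr_ge0.
have CXn : 0 <= CX / n%:R by rewrite divr_ge0.
have mC : measurable_fun [set: R] (fun t => C_bound B omega Lambda z n t `^ (p / 2)).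
  exact: (measurableT_comp (@measurable_powR R (p / 2)) (measurable_C_bound B omega Lambda z n)).
under eq_integral => t _.
  rewrite powRM ?sqrtr_ge0// -powR12_sqrt// -powRrM (mulrC 2^-1) EFinM; over.
rewrite ge0_integralZl//; last 3 first.
- by apply/measurable_EFinP; exact: measurable_funTS.
- by move=> t _; rewrite lee_fin powR_ge0.
- by rewrite lee_fin powR_ge0.
rewrite /S_bound EFinM /Rintegral fineK//.
have [T0|T0] := ltP T 0.
  by rewrite set_itv_ge ?integral_set0// bnd_simp -ltNge.
apply: integrable_fin_num => //; apply: measurable_bounded_integrable => //.
- by rewrite /= lebesgue_measure_itv /=; case: ifP => _; rewrite ?ltry.
- exact: measurable_funTS.
exists (C_bound B omega Lambda z n T `^ (p / 2)); split; first by rewrite num_real.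
move=> M TM t; rewrite /= in_itv /= => /andP[t0 tT]; rewrite ger0_norm ?powR_ge0//.
apply: le_trans (ltW TM); apply: ge0_ler_powR; rewrite ?nnegrE ?divr_ge0 ?(ltW p0)//.
exact: C_bound_le.
Qed.

(** For a > 0 each bound reads y <= -ln(a/2), a form that passes to the supremum and shows that A is
    bounded above; a = 0 is immediate, and nonemptiness excludes a = +oo. *)
Lemma le_expR_sup (A : set R) (a : \bar R) : (0 <= a)%E -> A !=set0 ->
    (forall y, A y -> (a <= (2 * expR (- y))%:E)%E) ->
  (a <= (2 * expR (- sup A))%:E)%E.
Proof.
move=> a0 A0; case: a a0 => [a| |//]; last first.
  by move=> _ Aa; have [y /Aa] := A0; rewrite leye_eq.
rewrite !lee_fin => a0 Aa.
have [->|an0] := eqVneq a 0; first by rewrite mulr_ge0 ?expR_ge0.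
have {a0 an0} a0 : 0 < a by rewrite lt_neqAle eq_sym an0.
have a20 : 0 < a / 2 by rewrite divr_gt0.
have : sup A <= - ln (a / 2).
  apply: ge_sup => // y Ay; rewrite lerNr -ler_expR lnK ?posrE//.
  by have := Aa y Ay; rewrite lee_fin ler_pdivrMr// mulrC.
by rewrite lerNr -ler_expR lnK ?posrE// ler_pdivrMr// mulrC.
Qed.

Lemma young_fenchel0_le phi : orlicz_N_function phi -> young_fenchel phi 0 <= 0.
Proof.
move=> Hphi; apply: ge_sup; first by exists (0 * 0 - phi 0), 0.
by move=> _ [y _ <-]; rewrite mul0r sub0r oppr_le0 orlicz_ge0.
Qed.

End main.

Theorem theorem3 (d : measure_display) (Omega : measurableType d) (R : realType)
    (P : probability Omega R)
    (p T omega Lambda z : R) (n : nat)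
    (p_ge1 : 1 <= p) (T_gt0 : 0 < T)
    (Lambda_gt0 : 0 < Lambda) (Lambda_lt_omega : Lambda < omega)
    (z_gt0 : 0 < z) (z_lt1 : z < 1)
    (n_gt0 : (0 < n)%N) (n_large : omega * T / (pi * Num.sqrt z) <= n%:R)
    (phi f : R -> R)
    (phi_N : orlicz_N_function phi) (phi_Q : condition_Q phi)
    (f_density : is_density phi f)
    (X : R -> Omega -> R) (B : R -> R) (CX : R)
    (X_meas : measurable_process X)
    (X_stationary : stationary P X B)
    (X_SSub : SSub P phi X CX)
    (X_bandlimited : bandlimited B Lambda) :
  let Xn := sampling_sum X omega n in
  let S := S_bound B CX omega Lambda z T p n in
  {ae P, forall w, lebesgue_measure.-integrable `[0, T]
           (fun t => (`|X t w - Xn t w| `^ p)%:E)} /\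
  (forall eps : R,
     S * f (p * (S / eps) `^ p^-1) `^ p < eps ->
     (P [set w | eps%:E <
          \int[lebesgue_measure]_(t in `[0%R, T])
               (`|X t w - Xn t w| `^ p)%R%:E]
      <= (2 * expR (- young_fenchel phi ((eps / S) `^ p^-1)))%:E)%E).
Proof.
move=> Xn S; have pi0 := pi_gt0 R; have p0 : 0 < p by apply: lt_le_trans p_ge1.
have n0R : 0 < n%:R :> R by rewrite ltr0n.
have B0 := stationary_var_ge0 X_stationary.
have [CX0 _ _] := X_SSub.
have phiN : forall x, phi (- x) = phi x by have [] := phi_N.
have mY := measurable_sampling_error omega n X_meas.
pose Y t w := X t w - Xn t w.
pose c t := CX / n%:R * Num.sqrt (C_bound B omega Lambda z n t).
have tauc t : 0 <= t <= T -> (tau P phi (Y t) <= (c t)%:E)%E.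
  by move=> t0T; exact: (sampling_tau_le Lambda_gt0 Lambda_lt_omega z_gt0 z_lt1 n_gt0 n_large t0T).
have cT t : 0 <= t <= T -> c t <= c T.
  move=> /andP[t0 tT]; rewrite /c ler_wpM2l ?divr_ge0 ?(ltW CX0)//.
  by rewrite ler_wsqrtr// C_bound_le.
have cge0 t : 0 <= c t by rewrite mulr_ge0 ?sqrtr_ge0// divr_ge0// ltW.
have mc : measurable_fun [set: R] c.
  apply: measurable_funM => //.
  have -> : (fun t => Num.sqrt (C_bound B omega Lambda z n t)) =
      (fun t => C_bound B omega Lambda z n t `^ 2^-1).
    by apply/funext => t; rewrite powR12_sqrt// mulr_ge0 ?sqr_ge0.
  exact: (measurableT_comp (@measurable_powR R 2^-1) (measurable_C_bound B omega Lambda z n)).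
have cS := S_boundE T Lambda_gt0 Lambda_lt_omega z_gt0 z_lt1 n_gt0 p_ge1 B0 (ltW CX0).
split.
  (* [c] vanishes when [B 0] does; the constant M is positive and dominates [c] on [0, T]. *)
  pose M := c T + 1; have M0 : 0 < M by rewrite ltr_wpDl.
  have MS : (\int[lebesgue_measure]_(t in `[0%R, T]) (M `^ p)%:E = (M `^ p * T)%:E)%E.
    rewrite integral_cst//= lebesgue_measure_itv /= lte_fin T_gt0.
    by rewrite -EFinB subr0 -EFinM.
  apply: (@ae_integrable_paths _ _ _ P T Y mY (cst M) phi p (M `^ p * T)) => //.
  - by rewrite mulr_gt0// powR_gt0.
  - move=> t l; rewrite /= in_itv /= => t0T; apply: mgf_le_tau => //.
    by apply: (le_trans (tauc _ t0T)); rewrite lee_fin ler_wpDr// cT.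
(* When S = 0, division by zero yields 0 and the claimed bound is 2 exp(-phi^*(0)) >= 1. *)
move=> eps Seps; have [S0|S0] := eqVneq S 0.
  rewrite S0 invr0 mulr0 powR0 ?invr_eq0 ?gt_eqF//.
  apply: (@le_trans _ _ 1%E).
    apply: probability_le1; rewrite -[X in measurable X]setTI.
    apply: emeasurable_fun_o_infty => //.
    exact: (measurable_Lp_integral (Y := Y) mY p (measurable_itv `[0, T])).
  rewrite lee_fin -[leLHS]mul1r ler_pM// ?ler1n// -expR0 ler_expR oppr_ge0.
  exact: young_fenchel0_le.
have {}S0 : 0 < S.
  rewrite lt_neqAle eq_sym S0 -lee_fin -cS.
  by apply: integral_ge0 => t _; rewrite lee_fin powR_ge0.
have fp0 : 0 <= f (p * (S / eps) `^ p^-1) `^ p by exact: powR_ge0.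
have eps0 : 0 < eps by apply: le_lt_trans Seps; rewrite mulr_ge0// ltW.
have eS0 : 0 < eps / S by rewrite divr_gt0.
set u := (eps / S) `^ p^-1; have u0 : 0 < u by rewrite powR_gt0.
have up : u `^ p = eps / S by rewrite -powRrM mulVf ?gt_eqF// powRr1// ltW.
have Sup : S * u `^ p = eps by rewrite up mulrC divfK// gt_eqF.
have uV : (S / eps) `^ p^-1 = u^-1.
  by rewrite -invf_div -(powR_inv1 (ltW eS0)) powRAC powR_inv1// ltW.
have pu0 : 0 <= p / u by rewrite divr_ge0// ltW.
(* The hypothesis on eps reads f(p/u)^p < eps / S = u^p. *)
have fu : f (p / u) <= u.
  have fpu := density_ge0 f_density pu0.
  move: Seps; rewrite uV -ltr_pdivlMl// [ltRHS]mulrC -up => Seps.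
  rewrite leNgt; apply/negP => uf; move: Seps; apply/negP; rewrite -leNgt.
  by apply: ge0_ler_powR; rewrite ?nnegrE ?(ltW p0) ?(ltW u0) ?(ltW uf).
(* A zero variance would give S = 0; positivity of [B 0] makes [c] positive, as the exponential
   weight requires. *)
have B0' : 0 < B 0.
  rewrite lt_neqAle B0 andbT; apply: contraTneq S0 => B00.
  rewrite -leNgt -lee_fin -cS integral0_eq// => t _.
  by rewrite /C_bound -B00 mul0r sqrtr0 mulr0 powR0 ?gt_eqF.
have c0 t : `[0%R, T]%classic t -> 0 < c t.
  rewrite /= in_itv /= => /andP[t0 _]; rewrite mulr_gt0 ?divr_gt0// sqrtr_gt0.
  exact: C_bound_gt0.
have mgf t l : `[0%R, T]%classic t -> ('M_P (Y t) l <= (expR (phi (c t * l)))%:E)%E.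
  by rewrite /= in_itv /= => t0T; apply: mgf_le_tau => //; exact: tauc.
apply: le_expR_sup; first exact: measure_ge0.
  by exists (u * 0 - phi 0), 0.
move=> _ [l _ <-].
(* [tail_le] requires l u >= p, so l is first replaced by some l' >= p / u that does at least as
   well. *)
have [l' pl' ll'] := young_fenchel_restrict l phi_N f_density pu0 (ltW u0) fu.
have := tail_le mY p_ge1 S0 phiN mc c0 cS mgf u0 (_ : p <= l' * u).
rewrite Sup -ler_pdivrMr// => /(_ pl') /le_trans; apply.
by rewrite lee_fin ler_pM2l// ler_expR lerN2.
Qed.
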